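(* Let $\mathbf A\in\mathbb R^{n\times d}$ (rank $d$) have a nondegenerate optimal design and let $\varepsilon\in(0,1)$. The two-stage algorithm consisting of the warm-start/identification loop with tolerance $c=c_0$ followed by the algorithm FacialNewton (both defined in the context), supplied with the instance constants $c_0,\gamma_{\mathrm{sc}}$, computes a $(1+\varepsilon)$-John ellipsoid, i.e. $\mathbf p\in\Delta_n$ with $\max_iv_i(\mathbf p)\le(1+\varepsilon)d$, using $$C(\mathbf A)+O\Big(d^2\log\log\frac{\Theta_{\mathrm N}}{\varepsilon}\Big)\ \text{ leverage-score queries},\qquad\Theta_{\mathrm N}=\frac{4\sqrt{3\widehat L_\star\kappa}}{d},$$ where $C(\mathbf A)=\max\{K_{\mathrm{id}},K_{\mathrm{gap}}(c_0/d)\}$ is independent of $\varepsilon$. In particular, once the optimal face is identified and the iterate is in the facial sublevel set $\mathcal C_0$, the accuracy phase costs $O(d^2\log\log(\Theta_{\mathrm N}/\varepsilon))$ queries.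
   Context: Setting. $\mathbf A\in\mathbb R^{n\times d}$ has rows $\mathbf a_1,\dots,\mathbf a_n$ and rank $d$. For $\mathbf p\in\mathbb R^n$, $\mathbf M(\mathbf p)=\sum_ip_i\mathbf a_i\mathbf a_i^\top$; when $\mathbf M(\mathbf p)\succ0$, $v_i(\mathbf p)=\mathbf a_i^\top\mathbf M(\mathbf p)^{-1}\mathbf a_i$ and $f(\mathbf p)=-\log\det\mathbf M(\mathbf p)$. $\Delta_n=\{\mathbf p\ge0:\sum p_i=1\}$ (designs), $g(\mathbf p)=\max_iv_i(\mathbf p)-d$. A leverage-score query at $\mathbf w$ with $\mathbf M(\mathbf w)\succ0$ returns $(v_i(\mathbf w))_{i\in[n]}$. Nondegeneracy. An optimal design $\mathbf p^\star$ minimizes $f$ over $\Delta_n$, $f^\star=f(\mathbf p^\star)$, $S^\star=\{i:v_i(\mathbf p^\star)=d\}$, $m=|S^\star|$. It is nondegenerate if (i) $\operatorname{supp}\mathbf p^\star=S^\star$ and $\gamma_{\mathrm{sc}}:=\min_{i\notin S^\star}(d-v_i(\mathbf p^\star))>0$ (minimum over the empty set is $+\infty$); (ii) $\{\mathbf a_i\mathbf a_i^\top\}_{i\in S^\star}$ are linearly independent. $p^\star_{\min}=\min_{i\in S^\star}p^\star_i$. Facial quantities. $V=\{\mathbf p\in\mathbb R^n:\operatorname{supp}\mathbf p\subseteq S^\star,\sum_ip_i=1\}$, $T^\star=\{\boldsymbol\delta:\operatorname{supp}\boldsymbol\delta\subseteq S^\star,\sum_i\delta_i=0\}$, $D=\{\mathbf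 p\in V:\mathbf M(\mathbf p)\succ0\}$, $h=f|_D$, $\widehat{\mathbf H}(\mathbf p)=\big((\mathbf a_i^\top\mathbf M(\mathbf p)^{-1}\mathbf a_j)^2\big)_{i,j\in S^\star}$. $\mu_\star=\lambda_{\min}(\widehat{\mathbf H}(\mathbf p^\star)|_{T^\star})$ (presupposing $T^\star\neq\{0\}$), $\widehat L_\star=\lambda_{\max}(\widehat{\mathbf H}(\mathbf p^\star))$, $\kappa=\widehat L_\star/\mu_\star$. $\zeta(t)=t-\log(1+t)$, $\bar r=\min\{\tfrac12,\gamma_{\mathrm{sc}}/(2d),p^\star_{\min}\sqrt{\mu_\star}/2\}$, $c_0=\zeta(\bar r)$, $\mathcal C_0=\{\mathbf p\in D:h(\mathbf p)\le f^\star+c_0\}$. Warm-start/identification loop (tolerance $c$). Start from the Kumar--Yıldırım volumetric initialization: greedily construct $d$ (near-)orthogonal directions, for each take the two rows of $\mathbf A$ extremal in that direction, and let $\mathbf p$ be the uniform design on these at most $2d$ rows (it satisfies $f(\mathbf p)-f^\star=O(d\log d)$). While $\max_iv_i(\mathbf p)-d>c$ or $\min_{i:p_i>0}v_i(\mathbf p)<d-\gamma_{\mathrm{sc}}/2$: query $\mathbf v=\mathbf v(\mathbf p)$, let $j_+\in\arg\max_iv_i$, $j_-\in\arg\min_{i:p_i>0}v_i$; if $v_{j_+}-d\ge d-v_{j_-}$ put $\gamma=\frac{v_{j_+}-d}{d(v_{j_+}-1)}$, $\mathbf p\leftarrow(1-\gamma)\mathbf p+\gamma\mathbf e_{j_+}$;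 otherwise put $\gamma_{\max}=\frac{p_{j_-}}{1-p_{j_-}}$, $\gamma=\min\{\frac{d-v_{j_-}}{d(v_{j_-}-1)},\gamma_{\max}\}$ if $v_{j_-}>1$ and $\gamma=\gamma_{\max}$ if $v_{j_-}\le1$, and $\mathbf p\leftarrow(1+\gamma)\mathbf p-\gamma\mathbf e_{j_-}$. (Away-step Frank--Wolfe steps with exact line search; one query per iteration.) Constants of the loop. Let $(\mathbf p^{(k)})$ be the sequence generated by this update without the stopping test. $K_{\mathrm{id}}$ is an index such that $\operatorname{supp}\mathbf p^{(k)}\subseteq S^\star$ for all $k\ge K_{\mathrm{id}}$; $K_{\mathrm{gap}}(\varepsilon')$ is an index such that $g(\mathbf p^{(k)})\le\varepsilon'd$ for all $k\ge K_{\mathrm{gap}}(\varepsilon')$. Both are finite by known results on away-step Frank--Wolfe (Zhao; Bomze--Rinaldi--Zeffiro). Algorithm FacialNewton, started at the exit point of the loop. Repeat, from the current $\mathbf p$: (1) query $\mathbf v=(v_i(\mathbf p))_{i\in[n]}$; if $\max_iv_i-d\le\varepsilon d$, return $\mathbf p$. (2) Query the $m$ designs $\tfrac12(\mathbf p+\mathbf e_j)$, $j\in S^\star$, and compute $\widehat{\mathbf H}=\widehat{\mathbf H}(\mathbf p)$ by $(\mathbf a_i^\top\mathbf M(\mathbf p)^{-1}\mathbf a_j)^2=(v_i(\mathbf p)-v_i(\mathbf p+\mathbf e_j))(1+v_j(\mathbf p))$, where $v_i(\mathbf p+\mathbf e_j)=\tfrac12v_i(\tfrac12(\mathbf p+\mathbf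 e_j))$. (3) Solve $\widehat{\mathbf H}\mathbf n+\nu\mathbf 1=(v_i)_{i\in S^\star}$, $\mathbf 1^\top\mathbf n=0$ for $(\mathbf n,\nu)\in\mathbb R^{S^\star}\times\mathbb R$, and put $\lambda=(\sum_{i\in S^\star}v_in_i)^{1/2}$. (4) If $\lambda>\tfrac14$ set $\mathbf p\leftarrow\mathbf p+\mathbf n/(1+\lambda)$, otherwise $\mathbf p\leftarrow\mathbf p+\mathbf n$ ($\mathbf n$ extended by $0$). Inside $O(\cdot)$, absolute constants are hidden and $\log\log X$ is read as $\max\{1,\log\log X\}$. *)

(* Defs.v *)
From mathcomp Require Import all_boot all_order all_algebra.
From mathcomp Require Import all_classical all_reals all_analysis.

Set Implicit Arguments.
Unset Strict Implicit.
Unset Printing Implicit Defensive.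

Import Order.TTheory GRing.Theory Num.Theory.
Local Open Scope ring_scope.

Section Design.
Variables (R : realType) (n d : nat) (A : 'M[R]_(n, d)).
Implicit Types (p q w : 'cV[R]_n) (S : {set 'I_n}).

Definition arow (i : 'I_n) : 'cV[R]_d := (row i A)^T.

Definition rank1 (i : 'I_n) : 'M[R]_d := arow i *m (arow i)^T.

Definition moment p : 'M[R]_d := \sum_i p i 0 *: rank1 i.

Definition posdef (k : nat) (B : 'M[R]_k) : Prop :=
  B^T = B /\ forall x : 'cV[R]_k, x != 0 -> 0 < (x^T *m B *m x) 0 0.

(* Meaningful only where [moment w] is positive definite. *)
Definition leverage w : 'cV[R]_n :=
  \col_i ((arow i)^T *m invmx (moment w) *m arow i) 0 0.

Definition objective p : R := - ln (\det (moment p)).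

Definition design p : Prop := (forall i, 0 <= p i 0) /\ \sum_i p i 0 = 1.

Definition supp p : {set 'I_n} := [set i | p i 0 != 0].

Definition vmax (v : 'cV[R]_n) : \bar R := \big[maxe/-oo%E]_i (v i 0)%:E.

Definition vmin_supp p (v : 'cV[R]_n) : \bar R :=
  \big[mine/+oo%E]_(i | 0 < p i 0) (v i 0)%:E.

Definition gap p : \bar R := (vmax (leverage p) - d%:R%:E)%E.

Definition john_ellipsoid (eps : R) p : Prop :=
  [/\ design p, posdef (moment p)
    & (vmax (leverage p) <= ((1 + eps) * d%:R)%:E)%E].

(* [objective] is read as +oo outside the positive definite cone. *)
Definition optimal_design p : Prop :=
  [/\ design p, posdef (moment p)
    & forall q, design q -> posdef (moment q) -> objective p <= objective q].

Definition contact_set p : {set 'I_n} := [set i | leverage p i 0 == d%:R].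

(* +oo when every row is in the contact set. *)
Definition gamma_sc p : \bar R :=
  \big[mine/+oo%E]_(i | i \notin contact_set p) (d%:R - leverage p i 0)%:E.

Definition nondegenerate_optimal p : Prop :=
  [/\ optimal_design p,
      supp p = contact_set p,
      (0 < gamma_sc p)%E
    & free [seq rank1 i | i in contact_set p]].

(* Vectors and matrices over a face [S] are indexed by ['I_#|S|] through
   [enum_val]. *)
Definition face_restrict S (x : 'cV[R]_n) : 'cV[R]_#|S| :=
  \col_k x (enum_val k) 0.

Definition face_extend S (x : 'cV[R]_#|S|) : 'cV[R]_n :=
  \sum_k x k 0 *: delta_mx (enum_val k) 0.

Definition facial_tangent S : set 'cV[R]_n :=
  [set x | supp x \subset S /\ \sum_i x i 0 = 0].

Definition facial_hessian S p : 'M[R]_#|S| :=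
  \matrix_(i, j) (((arow (enum_val i))^T *m invmx (moment p)
                     *m arow (enum_val j)) 0 0) ^+ 2.

(* Eigenvalues of the compression of [H] to the subspace [T]: [x] in [T] is an
   eigenvector when [H x - a x] is orthogonal to [T]. *)
Definition compression_eigenvalue S (H : 'M[R]_#|S|) (T : set 'cV[R]_n)
    (a : R) : Prop :=
  exists x, [/\ T x, x != 0 & forall y, T y ->
    ((face_restrict S y)^T *m H *m face_restrict S x) 0 0 =
      a * ((face_restrict S y)^T *m face_restrict S x) 0 0].

Definition mu_star p : R :=
  let S := contact_set p in
  inf [set a | compression_eigenvalue (facial_hessian S p) (facial_tangent S) a].

Definition L_star p : R :=
  sup [set a | eigenvalue (facial_hessian (contact_set p) p) a].

Definition kappa p : R := L_star p / mu_star p.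

Definition theta_N p : R := 4 * Num.sqrt (3 * L_star p * kappa p) / d%:R.

Definition zeta (t : R) : R := t - ln (1 + t).

Definition p_min p : \bar R := \big[mine/+oo%E]_(i in contact_set p) (p i 0)%:E.

Definition r_bar p : R :=
  fine (mine (2^-1)%:E
         (mine (gamma_sc p * ((2 * d%:R)^-1)%:E)
               (p_min p * (Num.sqrt (mu_star p) / 2)%:E)))%E.

Definition c_zero p : R := zeta (r_bar p).

Definition facial_sublevel (ps : 'cV[R]_n) : set 'cV[R]_n :=
  [set p | [/\ supp p \subset contact_set ps, \sum_i p i 0 = 1,
               posdef (moment p) & objective p <= objective ps + c_zero ps]].

Definition uniform_design S : 'cV[R]_n := \col_i ((i \in S)%:R / #|S|%:R).

(* Kumar-Yildirim initialization for the symmetric point set {a_i, - a_i}: each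
   new direction [b k] is orthogonal to the points found so far, [hi k] and
   [lo k] are the extremal rows along it, and [top k], the one of the two that
   is farther from the origin along [b k], is the point added to the span. *)
Definition volumetric_init p : Prop :=
  exists (b : 'I_d -> 'cV[R]_d) (hi lo top : 'I_d -> 'I_n),
    let along k i := ((b k)^T *m arow i) 0 0 in
    [/\ forall k, b k != 0 /\
          (forall l : 'I_d, (l < k)%N -> along k (top l) = 0),
        forall k i, along k (lo k) <= along k i <= along k (hi k),
        forall k, top k \in [:: hi k; lo k] /\
          (forall i, `|along k i| <= `|along k (top k)|)
      & p = uniform_design ([set hi k | k in 'I_d] :|: [set lo k | k in 'I_d])].

End Design.

(* The algorithms see the data only through [query], which maps a design to the
   vector of its leverage scores. *)
Section Algorithms.
Variables (R : realType) (n d : nat) (query : 'cV[R]_n -> 'cV[R]_n).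
Implicit Types (p q v : 'cV[R]_n) (S : {set 'I_n}).

Definition loop_continues (c : R) (gamma : \bar R) p : bool :=
  let v := query p in
  ((c%:E < vmax v - d%:R%:E) ||
   (vmin_supp p v < d%:R%:E - gamma * (2^-1)%:E))%E.

Definition away_stepsize (pj vj : R) : R :=
  let gmax := pj / (1 - pj) in
  if 1 < vj then Num.min ((d%:R - vj) / (d%:R * (vj - 1))) gmax else gmax.

Definition away_step_update p q : Prop :=
  let v := query p in
  exists jp jm : 'I_n,
    [/\ forall i, v i 0 <= v jp 0,
        0 < p jm 0 /\ (forall i, 0 < p i 0 -> v jm 0 <= v i 0)
      & q = if d%:R - v jm 0 <= v jp 0 - d%:R
            then let g := (v jp 0 - d%:R) / (d%:R * (v jp 0 - 1)) in
                 (1 - g) *: p + g *: delta_mx jp 0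
            else let g := away_stepsize (p jm 0) (v jm 0) in
                 (1 + g) *: p - g *: delta_mx jm 0].

Definition loop_exits_at (c : R) (gamma : \bar R) (p : nat -> 'cV[R]_n)
    (N : nat) : Prop :=
  (forall k, (k < N)%N -> loop_continues c gamma (p k)) /\
  ~~ loop_continues c gamma (p N).

Definition queried_hessian S p : 'M[R]_#|S| :=
  \matrix_(i, j)
    let vi_shift :=
      2^-1 * query (2^-1 *: (p + delta_mx (enum_val j) 0)) (enum_val i) 0 in
    (query p (enum_val i) 0 - vi_shift) * (1 + query p (enum_val j) 0).

Definition newton_system S p (z : 'cV[R]_#|S| * R) : Prop :=
  queried_hessian S p *m z.1 + z.2 *: const_mx 1 = face_restrict S (query p) /\
  \sum_k z.1 k 0 = 0.

(* [unique]: solving the system is required to be well posed, so that a step is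
   deterministic. *)
Definition newton_update S p q : Prop :=
  exists z : 'cV[R]_#|S| * R,
    unique (newton_system p) z /\
    let lambda := Num.sqrt (\sum_k face_restrict S (query p) k 0 * z.1 k 0) in
    q = if 4^-1 < lambda then p + (1 + lambda)^-1 *: face_extend z.1
        else p + face_extend z.1.

(* [facial_newton S eps p t r]: started at [p], the algorithm on the face [S]
   terminates and returns [r] after having queried exactly the designs in [t]. *)
Inductive facial_newton S (eps : R) :
    'cV[R]_n -> seq 'cV[R]_n -> 'cV[R]_n -> Prop :=
| facial_newton_return p :
    (vmax (query p) - d%:R%:E <= (eps * d%:R)%:E)%E ->
    facial_newton S eps p [:: p] p
| facial_newton_step p q t r :
    ~~ (vmax (query p) - d%:R%:E <= (eps * d%:R)%:E)%E ->
    newton_update S p q ->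
    facial_newton S eps q t r ->
    facial_newton S eps p
      (p :: [seq 2^-1 *: (p + delta_mx j 0) | j <- enum S] ++ t) r.

End Algorithms.

Section Loop.
Variables (R : realType) (n d : nat) (A : 'M[R]_(n, d)).
Implicit Types p : nat -> 'cV[R]_n.

Definition away_sequence p : Prop :=
  volumetric_init A (p 0%N) /\
  forall k, away_step_update d (leverage A) (p k) (p k.+1).

Definition is_K_id (S : {set 'I_n}) p (K : nat) : Prop :=
  forall k, (K <= k)%N -> supp (p k) \subset S.

Definition is_K_gap p (eps' : R) (K : nat) : Prop :=
  forall k, (K <= k)%N -> (gap A (p k) <= (eps' * d%:R)%:E)%E.

(* The last entry pays for the stopping test that ends the loop. *)
Definition loop_queries p (N : nat) : seq 'cV[R]_n := mkseq p N.+1.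

Definition legal_queries (t : seq 'cV[R]_n) : Prop :=
  forall w, w \in t -> posdef (moment A w).

End Loop.

Definition loglog (R : realType) (x : R) : R := Num.max 1 (ln (ln x)).

(* Main.v *)
(* For positive definite M(p), the pencil (M(p), M(x)) is diagonalized
   simultaneously, with relative eigenvalues e_k: the objective along p + x
   becomes -sum ln (1 + e_k), the local norm of x is the Euclidean norm of e, and
   every estimate is one on scalars.

   Loop. A toward step, or an away step with untruncated step size, at a vertex
   of leverage v decreases the objective by an explicit gain that is bounded
   below when v stays away from d; the remaining steps drop a vertex, so they
   cannot occur forever. Hence the objective converges to its optimum, and so do
   the leverage scores because sum zeta(e_k) <= zeta(r) forces |e| <= r. Once the
   scores off the face are below d - gamma_sc / 2, only off-face vertices can be
   dropped and none is added, which identifies the face. When the loop stops, the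
   duality gap bounds the objective excess by c_zero = zeta(r_bar), and the
   choice of r_bar turns |e| <= r_bar into support and positivity information.

   Newton. A damped step with decrement > 1/4 decreases the objective by at least
   1/80, and the excess is at most 3/8 on the sublevel set; afterwards a full step
   squares the decrement lambda. As the gap is at most 3 d lambda and
   theta_N >= 4, O(loglog (theta_N / eps)) iterations of 1 + |S| <= 2 d^2 queries
   suffice. *)

From HB Require Import structures.
Require Import Defs.
From mathcomp Require Import all_boot all_order all_algebra.
From mathcomp Require Import all_classical all_reals all_analysis.
From mathcomp Require Import zify ring lra.

Set Implicit Arguments.
Unset Strict Implicit.
Unset Printing Implicit Defensive.

Import Order.TTheory GRing.Theory Num.Theory.
Local Open Scope ring_scope.

(** * Real spectral theorem and Rayleigh quotients *)

(** The theorem asks only that [K_id] and [K_gap] exist, so the loop can be analysed without rates: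
    an objective that decreases and is bounded below has vanishing decrements, and a step with small
    decrement that drops no vertex already has all leverage scores at most slightly above d. Rates
    matter only for Newton, and there they are absolute: gap and decrement are compared by
    Cauchy-Schwarz in the local norm, on the vector e_i - p, and conditioning enters only through
    [theta_N]. Both stages rest on one inequality, an objective excess of at most zeta(r). The
    first-order term at the optimum has a sign on the simplex and vanishes on the affine hull of the
    face, so the excess bounds the local distance to [ps] by r, and the leverage scores agree up to
    factors 1 - r and 1 + r. A nonzero tangent vector gives |S| >= 2, and independence of the
    rank-one matrices then forces d >= 2, which the divisions by d - 1 and v - 1 require. As
    [mu_star] and [L_star] are an inf and a sup, they mean something only for nonempty bounded sets;
    attained Rayleigh quotients supply this. *)

Section Spectral.
Import numFieldNormedType.Exports.
Variable R : realType.

Lemma continuous_big_sum (T : topologicalType) (I : Type) (s : seq I)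
    (F : I -> T -> R) :
  (forall i, continuous (F i)) -> continuous (fun x => \sum_(i <- s) F i x).
Proof.
move=> cF x; elim: s => [|i s IH].
  rewrite (_ : (fun _ => _) = fun=> 0); first exact: cst_continuous.
  by apply/funext => y; rewrite big_nil.
rewrite (_ : (fun _ => _) = F i \+ (fun y => \sum_(j <- s) F j y)).
  by apply: continuousD => //; exact: cF.
by apply/funext => y; rewrite big_cons.
Qed.

(** Presenting the subspace as a kernel lets one argument serve the whole space ([B] = 0), the
    orthogonal complement of eigenvectors already found, and the sum-zero vectors. *)
Lemma compact_unit_sphere_ker n k (B : 'M[R]_(n, k)) :
  compact [set x : 'rV[R]_n | x *m B = 0 /\ (x *m x^T) 0 0 = 1].
Proof.
apply: bounded_closed_compact.
  exists 1; split; first exact: num_real.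
  move=> M M1 x [_ xx].
  rewrite /= -[`|x|]/(mx_norm x) mx_normrE; apply: bigmax_le => /=.
    by rewrite (le_trans _ (ltW M1)).
  move=> [i j] _ /=; rewrite ord1; apply: le_trans (ltW M1).
  rewrite -(@ler_pXn2r _ 2) ?nnegrE // expr1n real_normK ?num_real //.
  rewrite -xx mxE (bigD1 j) //= mxE -expr2 lerDl sumr_ge0 // => l _.
  by rewrite mxE -expr2 sqr_ge0.
have -> : [set x : 'rV[R]_n | x *m B = 0 /\ (x *m x^T) 0 0 = 1]%classic =
    ((\bigcap_(j in setT) ((fun x : 'rV[R]_n => (x *m B) 0 j) @^-1` [set y | y = 0]))
     `&` (fun x : 'rV[R]_n => (x *m x^T) 0 0) @^-1` [set y | y = 1])%classic.
  apply/seteqP; split=> x /=.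
    by move=> [xB ->]; split => // j _ /=; rewrite xB mxE.
  by move=> [xB ->]; split => //; apply/rowP => j; rewrite (xB j) // mxE.
apply: closedI.
  apply: closed_bigI => j _; apply: preimage_closed (closed_eq (y := 0)) => x _.
  rewrite (_ : (fun _ => _) = fun x : 'rV[R]_n => \sum_i x 0 i * B i j).
    apply: continuous_big_sum => i y.
    by apply: continuousM; [exact: coord_continuous|exact: cst_continuous].
  by apply/funext => y; rewrite mxE.
apply: preimage_closed (closed_eq (y := 1)) => x _.
rewrite (_ : (fun _ => _) = fun x : 'rV[R]_n => \sum_i x 0 i * x 0 i).
  apply: continuous_big_sum => i y.
  by apply: continuousM; exact: coord_continuous.
by apply/funext => y; rewrite mxE; apply: eq_bigr => i _; rewrite mxE.
Qed.

Lemma quadratic_form_continuous n (H : 'M[R]_n) :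
  continuous (fun x : 'rV[R]_n => (x *m H *m x^T) 0 0).
Proof.
rewrite (_ : (fun _ => _) =
    fun x : 'rV[R]_n => \sum_i (\sum_j x 0 j * H j i) * x 0 i).
  apply: continuous_big_sum => i y.
  apply: continuousM; last exact: coord_continuous.
  apply: continuous_big_sum => j z.
  by apply: continuousM; [exact: coord_continuous|exact: cst_continuous].
by apply/funext => y; rewrite mxE; apply: eq_bigr => i _; rewrite !mxE.
Qed.

Lemma bilinear_formC n (H : 'M[R]_n) (x y : 'cV[R]_n) : H^T = H ->
  (x^T *m H *m y) 0 0 = (y^T *m H *m x) 0 0.
Proof.
move=> sH; have -> : y^T *m H *m x = (x^T *m H *m y)^T.
  by rewrite !trmx_mul sH trmxK mulmxA.
by rewrite [RHS]mxE.
Qed.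

Lemma dotC n (x y : 'cV[R]_n) : (x^T *m y) 0 0 = (y^T *m x) 0 0.
Proof. by rewrite !mxE; apply: eq_bigr => i _; rewrite !mxE mulrC. Qed.

Lemma dot_sum n (x y : 'cV[R]_n) : (x^T *m y) 0 0 = \sum_i x i 0 * y i 0.
Proof. by rewrite mxE; apply: eq_bigr => i _; rewrite mxE. Qed.

Lemma sqnorm_ge0 n (x : 'cV[R]_n) : 0 <= (x^T *m x) 0 0.
Proof. by rewrite dot_sum sumr_ge0 // => i _; rewrite -expr2 sqr_ge0. Qed.

Lemma sqnorm_eq0 n (x : 'cV[R]_n) : (x^T *m x) 0 0 = 0 -> x = 0.
Proof.
rewrite dot_sum => /eqP; rewrite psumr_eq0; last first.
  by move=> i _; rewrite -expr2 sqr_ge0.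
move/allP => h; apply/colP => i; rewrite mxE.
by have := h i; rewrite mem_index_enum -expr2 sqrf_eq0 => /(_ isT) /eqP.
Qed.

Lemma sqnorm_gt0 n (x : 'cV[R]_n) : x != 0 -> 0 < (x^T *m x) 0 0.
Proof.
move=> x0; rewrite lt_def sqnorm_ge0 andbT; apply: contra x0 => /eqP.
by move/sqnorm_eq0 ->.
Qed.

Lemma linear_form_quadratic_ge0 (c e : R) :
  0 <= e -> (forall t, 0 <= 2 * t * c + t ^+ 2 * e) -> c = 0.
Proof.
(* At this t the form is negative unless c = 0; dividing by e + 1 rather than e covers e = 0. *)
move=> e0 /(_ (- c / (e + 1))).
have e1 : 0 < e + 1 by lra.
have -> : 2 * (- c / (e + 1)) * c + (- c / (e + 1)) ^+ 2 * e =
  - (c ^+ 2 * (e + 2) / (e + 1) ^+ 2) by field; lra.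
rewrite oppr_ge0 => h; apply/eqP; rewrite -sqrf_eq0 eq_le sqr_ge0 andbT.
have : 0 < (e + 2) / (e + 1) ^+ 2 by rewrite divr_gt0 ?exprn_gt0 //; lra.
by move=> p; rewrite -(pmulr_lle0 _ p) mulrA.
Qed.

Lemma quadratic_formD n (H : 'M[R]_n) (x y : 'cV[R]_n) t : H^T = H ->
  ((x + t *: y)^T *m H *m (x + t *: y)) 0 0 =
  (x^T *m H *m x) 0 0 + 2 * t * (y^T *m H *m x) 0 0 + t ^+ 2 * (y^T *m H *m y) 0 0.
Proof.
move=> sH.
have -> : (x + t *: y)^T *m H *m (x + t *: y) =
    x^T *m H *m x + t *: (x^T *m H *m y) + t *: (y^T *m H *m x)
    + (t ^+ 2) *: (y^T *m H *m y).
  have -> : (x + t *: y)^T = x^T + t *: y^T by apply/matrixP => i j; rewrite !mxE.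
  rewrite !mulmxDl !mulmxDr -!scalemxAl -!scalemxAr.
  by rewrite scalerA -expr2 !addrA.
have mD (X Y : 'M[R]_1) : (X + Y) 0 0 = X 0 0 + Y 0 0 by rewrite mxE.
have mZ c (X : 'M[R]_1) : (c *: X) 0 0 = c * X 0 0 by rewrite mxE.
rewrite !mD !mZ.
by rewrite (bilinear_formC x y sH); ring.
Qed.

(* The minimum of the Rayleigh quotient of [H] over [ker B] is attained, and the
   first-order condition makes the minimizer an eigenvector of the compression
   of [H] to [ker B]. *)
Lemma rayleigh_min_ker n k (H : 'M[R]_n) (B : 'M[R]_(k, n)) :
  H^T = H -> (exists2 x : 'cV[R]_n, B *m x = 0 & x != 0) ->
  exists a (x : 'cV[R]_n), [/\ B *m x = 0, x != 0,
    forall y : 'cV[R]_n, B *m y = 0 ->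
      (y^T *m H *m x) 0 0 = a * (y^T *m x) 0 0 &
    forall y : 'cV[R]_n, B *m y = 0 ->
      a * (y^T *m y) 0 0 <= (y^T *m H *m y) 0 0].
Proof.
move=> sH [x0 Bx0 x00].
pose K := [set x : 'rV[R]_n | x *m B^T = 0 /\ (x *m x^T) 0 0 = 1]%classic.
have nrm (y : 'cV[R]_n) : B *m y = 0 -> y != 0 ->
    let s := (Num.sqrt ((y^T *m y) 0 0))^-1 in K (s *: y^T).
  move=> By y0 s; have yp := sqnorm_gt0 y0; split.
    by rewrite -scalemxAl -trmx_mul By linear0 scaler0.
  rewrite linearZ /= trmxK -scalemxAl -scalemxAr scalerA [LHS]mxE.
  rewrite -expr2 exprVn sqr_sqrtr ?(ltW yp) // mulVf //.
  by rewrite gt_eqF.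
have K0 : (K !=set0)%classic by exists ((Num.sqrt ((x0^T *m x0) 0 0))^-1 *: x0^T); exact: nrm.
have [x xK xmin] := EVT_min_rV K0 (compact_unit_sphere_ker (B := B^T))
  (continuous_subspaceT (quadratic_form_continuous (H := H))).
move: xK; rewrite inE => -[Bx nx].
have x1 : x != 0 by apply: contra_eqN nx => /eqP ->; rewrite mul0mx mxE eq_sym oner_eq0.
pose a := (x *m H *m x^T) 0 0.
have hom (y : 'cV[R]_n) : B *m y = 0 ->
      a * (y^T *m y) 0 0 <= (y^T *m H *m y) 0 0.
  move=> By; have [->|y0] := eqVneq y 0.
    by rewrite !mulmx0 mxE mulr0.
  have yp := sqnorm_gt0 y0; have := nrm _ By y0; set s := _^-1 => /mem_set /xmin.
  rewrite linearZ /= trmxK -!scalemxAl -!scalemxAr scalerA [X in _ <= X -> _]mxE.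
  rewrite -expr2 exprVn sqr_sqrtr ?(ltW yp) // -/a.
  by rewrite -/a ler_pdivlMl // mulrC.
exists a, x^T; split => //.
- by apply: trmx_inj; rewrite trmx_mul trmxK Bx linear0.
- by apply: contra x1 => /eqP /(congr1 trmx); rewrite trmxK linear0 => ->.
move=> y By.
apply/eqP; rewrite -subr_eq0; apply/eqP.
apply: (@linear_form_quadratic_ge0 _ ((y^T *m H *m y) 0 0 - a * (y^T *m y) 0 0)).
  by rewrite subr_ge0 hom.
move=> t.
have Bxy : B *m (x^T + t *: y) = 0.
  rewrite mulmxDr -scalemxAr By scaler0 addr0.
  by apply: trmx_inj; rewrite trmx_mul trmxK Bx linear0.
have := hom _ Bxy; rewrite quadratic_formD // -{1}[(_ + _)^T]mulmx1 quadratic_formD ?trmx1 //.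
by rewrite !mulmx1 trmxK nx -/a; lra.
Qed.

(** Eigenvectors are collected one by one: the next minimizes the Rayleigh quotient on the
    orthogonal complement of the rows of [U]. *)
Lemma spectral_partial n (H : 'M[R]_n) k : H^T = H -> (k <= n)%N ->
  exists (U : 'M[R]_(k, n)) (e : 'rV[R]_k),
    U *m U^T = 1%:M /\ U *m H = diag_mx e *m U.
Proof.
move=> sH; elim: k => [|k IH] kn.
  by exists 0, 0; split; apply/matrixP => -[].
have [U [e [UU UH]]] := IH (ltnW kn).
have ex : exists2 x : 'cV[R]_n, U *m x = 0 & x != 0.
  have : kermx U^T != 0.
    by rewrite -mxrank_eq0 mxrank_ker -lt0n subn_gt0 (leq_ltn_trans _ kn) // rank_leq_col.
  case/rowV0Pn => v /sub_kermxP vU v0; exists v^T.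
    by apply: trmx_inj; rewrite trmx_mul trmxK vU linear0.
  by apply: contra v0 => /eqP /(congr1 trmx); rewrite trmxK linear0 => ->.
have [a [x [Ux x0 ex1 _]]] := rayleigh_min_ker sH ex.
have HU : H *m U^T = U^T *m diag_mx e.
  by apply: trmx_inj; rewrite !trmx_mul trmxK sH UH tr_diag_mx.
(* The complement is invariant under [H], so the residual is itself an admissible test vector;
   paired with itself it gives zero. *)
have Hx : H *m x = a *: x.
  apply/eqP; rewrite -subr_eq0; apply/eqP; apply: sqnorm_eq0.
  set y := _ - _.
  have Uy : U *m y = 0.
    by rewrite mulmxBr mulmxA UH -mulmxA -scalemxAr Ux mulmx0 scaler0 subrr.
  rewrite {2}/y mulmxBr -scalemxAr mulmxA [LHS]mxE [X in _ + X]mxE [X in _ - X]mxE.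
  by rewrite ex1 // subrr.
have xp := sqnorm_gt0 x0.
pose s := (Num.sqrt ((x^T *m x) 0 0))^-1.
pose u := s *: x^T.
have uu : u *m u^T = 1%:M.
  apply/matrixP => i j; rewrite !ord1 linearZ /= trmxK -scalemxAl -scalemxAr.
  rewrite scalerA [LHS]mxE [RHS]mxE.
  by rewrite -expr2 exprVn sqr_sqrtr ?(ltW xp) // mulVf // gt_eqF.
have Uu : U *m u^T = 0 by rewrite linearZ /= trmxK -scalemxAr Ux scaler0.
rewrite -addn1.
exists (col_mx U u), (row_mx e (const_mx a)); split.
  rewrite tr_col_mx mul_col_mx !mul_mx_row UU Uu uu -[u *m U^T]trmxK trmx_mul trmxK Uu.
  by rewrite linear0 scalar_mx_block.
rewrite mul_col_mx UH diag_mx_row mul_block_col !mul0mx addr0 add0r; congr col_mx.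
rewrite -scalemxAl -[x^T *m H]trmxK trmx_mul trmxK sH Hx linearZ /=.
by rewrite diag_const_mx mul_scalar_mx scalerA mulrC -scalerA.
Qed.

Lemma spectral_theorem n (H : 'M[R]_n) : H^T = H ->
  exists (U : 'M[R]_n) (e : 'rV[R]_n),
    U *m U^T = 1%:M /\ U *m H *m U^T = diag_mx e.
Proof.
move=> sH; have [U [e [UU UH]]] := spectral_partial sH (leqnn n).
by exists U, e; split=> //; rewrite UH -mulmxA UU mulmx1.
Qed.

(** Whitening turns [M] into the identity; diagonalizing the transformed [N] by an orthogonal matrix
    leaves that identity intact. *)
Lemma simultaneous_diag n (M N : 'M[R]_n) : posdef M -> N^T = N ->
  exists (P : 'M[R]_n) (e : 'rV[R]_n),
    [/\ P \in unitmx, P *m M *m P^T = 1%:M & P *m N *m P^T = diag_mx e].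
Proof.
move=> [sM pM] sN.
have [U [e [UU UM]]] := spectral_theorem sM.
have uU : U \in unitmx by case: (mulmx1_unit UU).
have ep i : 0 < e 0 i.
  have Ui : (row i U)^T != 0.
    apply/eqP => /(congr1 trmx); rewrite trmxK trmx0 => r0.
    have := congr1 (fun B : 'M[R]_n => B i i) UU.
    rewrite !mxE eqxx big1 => [/eqP|j _]; first by rewrite eq_sym oner_eq0.
    by have := congr1 (fun B : 'rV[R]_n => B 0 j) r0; rewrite mxE => ->; rewrite mxE mul0r.
  have := congr1 (fun B : 'M[R]_n => B i i) UM; rewrite [RHS]mxE eqxx mulr1n => <-.
  have := pM _ Ui; congr (0 < _); rewrite trmxK -row_mul [LHS]mxE [RHS]mxE.
  by apply: eq_bigr => j _; rewrite !mxE.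
pose s := \row_i (Num.sqrt (e 0 i))^-1.
pose Q := diag_mx s *m U.
have uQ : Q \in unitmx.
  rewrite unitmx_mul uU andbT unitmxE det_diag unitfE prodf_seq_neq0.
  by apply/allP => i _; rewrite mxE invr_eq0 gt_eqF // sqrtr_gt0.
have QM : Q *m M *m Q^T = 1%:M.
  rewrite trmx_mul tr_diag_mx -!mulmxA (mulmxA U) (mulmxA _ U^T) UM.
  apply/matrixP => i j; rewrite mul_diag_mx mxE mul_mx_diag !mxE.
  have [->|] := eqVneq i j; last by rewrite mulr0n mul0r mulr0.
  rewrite mulr1n mulrA mulrAC -expr2 exprVn sqr_sqrtr ?(ltW (ep j)) // mulVf //.
  by rewrite gt_eqF.
clearbody Q; have sN' : (Q *m N *m Q^T)^T = Q *m N *m Q^T.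
  by rewrite !trmx_mul trmxK sN mulmxA.
have [V [f [VV VN]]] := spectral_theorem sN'.
exists (V *m Q), f; split.
- by rewrite unitmx_mul uQ andbT; case: (mulmx1_unit VV).
- have -> : V *m Q *m M *m (V *m Q)^T = V *m (Q *m M *m Q^T) *m V^T.
    by rewrite trmx_mul !mulmxA.
  by rewrite QM mulmx1.
- by rewrite -VN (trmx_mul V) !mulmxA.
Qed.

End Spectral.

(** * Scalar inequalities *)

Section ScalarBounds.
Import numFieldNormedType.Exports.
Variable R : realType.
Implicit Types x r t : R.

Lemma ln_ltsub1 x : 0 < x -> x != 1 -> ln x < x - 1.
Proof.
move=> x0 x1; rewrite -[ltRHS]expRK ltr_ln ?posrE ?expR_gt0 //.
have h : x - 1 != 0 by rewrite subr_eq0.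
by have := expR_gt1Dx h; rewrite subrKC.
Qed.

Lemma ln_lesub1 x : 0 < x -> ln x <= x - 1.
Proof.
move=> x0; have [->|x1] := eqVneq x 1; first by rewrite ln1 subrr.
exact/ltW/ln_ltsub1.
Qed.

Lemma ln_ge1subV x : 0 < x -> 1 - x^-1 <= ln x.
Proof.
move=> x0; have := @ln_lesub1 x^-1; rewrite invr_gt0 => /(_ x0).
by rewrite lnV ?posrE //; lra.
Qed.

Lemma zeta_ge0 x : -1 < x -> 0 <= zeta x.
Proof. by move=> x1; rewrite /zeta subr_ge0 le_ln1Dx. Qed.

Lemma zeta_gt0 x : 0 < x -> 0 < zeta x.
Proof.
move=> x0; rewrite /zeta; have := @ln_ltsub1 (1 + x).
by rewrite -subr_eq0 [_ - 1]addrC addKr gt_eqF // => /(_ _ isT); lra.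
Qed.

Lemma zeta_lt x y : 0 < x -> x < y -> zeta x < zeta y.
Proof.
move=> x0 xy; rewrite /zeta.
have := @ln_lesub1 ((1 + y) / (1 + x)); rewrite divr_gt0 ?ln_div ?posrE; try lra.
move=> /(_ isT).
have -> : (1 + y) / (1 + x) - 1 = (y - x) / (1 + x) by field; lra.
have : (y - x) / (1 + x) < y - x.
  by rewrite ltr_pdivrMr; nra.
lra.
Qed.

(* [zeta (s * x) / x ^ 2] has [s]-derivative [s / (1 + s * x)], which is
   nonincreasing in [x]; integrating over [0 <= s <= 1] gives the claim. *)
Lemma zeta_div_sqr_le x r : -1 < x -> x <= r -> 0 < r ->
  x ^+ 2 * zeta r <= r ^+ 2 * zeta x.
Proof.
move=> x1 xr r0.
pose f (s : R) := r ^+ 2 * zeta (s * x) - x ^+ 2 * zeta (s * r).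
have pos (s y : R) : -1 < y -> 0 <= s <= 1 -> 0 < 1 + s * y.
  move=> y1 /andP[s0 s1].
  have [y0|y0] := leP 0 y; first by have := mulr_ge0 s0 y0; lra.
  have : s * y >= y by nra.
  by lra.
have dz (s y : R) : 0 < 1 + s * y ->
    is_derive s 1 (fun s => zeta (s * y)) (y - y / (1 + s * y)).
  move=> p; rewrite /zeta.
  have h1 : is_derive s (1 : R) (fun s : R => s * y) y.
    apply: is_derive_eq (is_deriveM (is_derive_id s (1 : R)) (is_derive_cst y s (1 : R))) _.
    by rewrite scaler0 add0r /GRing.scale /= mulr1.
  have h2 : is_derive s (1 : R) (fun s : R => 1 + s * y) y.
    have h := is_deriveD (is_derive_cst (1 : R) s (1 : R)) h1.
    by apply: is_derive_eq h _; rewrite add0r.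
  have h3 : is_derive (1 + s * y) (1 : R) (@ln R) (1 + s * y)^-1 by exact: is_derive1_ln.
  have h4 := @is_derive1_comp _ (@ln R) (fun s : R => 1 + s * y) s _ _ h3 h2.
  have h := is_deriveB h1 h4; apply: is_derive_eq h _.
  by rewrite mulrC.
have df (s : R) : 0 <= s <= 1 -> is_derive s 1 f
   (r ^+ 2 * (x - x / (1 + s * x)) - x ^+ 2 * (r - r / (1 + s * r))).
  move=> s01.
  have h1 := dz s x (pos s x x1 s01).
  have h2 : is_derive s 1 (fun s => zeta (s * r)) (r - r / (1 + s * r)).
    by apply: dz; apply: pos => //; lra.
  have h3 := is_deriveZ (r ^+ 2) h1; have h4 := is_deriveZ (x ^+ 2) h2.
  have h := is_deriveB h3 h4; apply: is_derive_eq h _.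
  by rewrite /GRing.scale /=; ring.
have : f 0 <= f 1.
  apply: (@ger0_derive1_le_cc _ f 0 1).
  - by move=> s; rewrite in_itv /= => /andP[/ltW s0 /ltW s1]; have [] := df s; rewrite ?s0.
  - move=> s; rewrite in_itv /= => /andP[s0 s1].
    have s01 : 0 <= s <= 1 by rewrite !ltW.
    rewrite derive1E; have := df s s01 => d; rewrite derive_val.
    have px := pos s x x1 s01; have pr : 0 < 1 + s * r by apply: pos => //; lra.
    have -> : r ^+ 2 * (x - x / (1 + s * x)) - x ^+ 2 * (r - r / (1 + s * r)) =
       r ^+ 2 * x ^+ 2 * s * ((s * (r - x)) / ((1 + s * x) * (1 + s * r))).
      by field; rewrite !gt_eqF.
    apply: mulr_ge0; first exact: mulr_ge0 (mulr_ge0 (sqr_ge0 r) (sqr_ge0 x)) (ltW s0).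
    by rewrite divr_ge0 // mulr_ge0 ?subr_ge0 // ltW.
  - apply: derivable_within_continuous => s.
    by rewrite in_itv /= => s01; have [] := df s s01.
  - by rewrite in_itv /= lexx ler01.
  - by rewrite in_itv /= lexx ler01.
  - exact: ler01.
by rewrite /f !mul0r !mul1r /zeta !addr0 ln1 subrr !mulr0 subrr subr_ge0.
Qed.

(** The terms are nonnegative, so monotonicity on the positive side gives e_i <= r for each i; then
    zeta(e_i) / e_i^2 is at least zeta(r) / r^2, whatever the sign of e_i. *)
Lemma sum_zeta_le (I : finType) (e : I -> R) r : (forall i, -1 < e i) -> 0 < r ->
  \sum_i zeta (e i) <= zeta r -> \sum_i e i ^+ 2 <= r ^+ 2.
Proof.
move=> e1 r0 h.
have er i : e i <= r.
  rewrite leNgt; apply/negP => /(zeta_lt r0); apply/negP; rewrite -leNgt.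
  apply: le_trans h; rewrite (bigD1 i) //= lerDl sumr_ge0 // => j _.
  exact: zeta_ge0.
rewrite -(ler_pM2r (zeta_gt0 r0)) mulr_suml.
apply: le_trans (_ : \sum_i r ^+ 2 * zeta (e i) <= _).
  by apply: ler_sum => i _; exact: zeta_div_sqr_le.
by rewrite -mulr_sumr ler_wpM2l ?sqr_ge0.
Qed.

(* Applying [ln u >= 1 - u^-1] at [u = sqrt (1 + x)]. *)
Lemma zeta_le_quadratic x : `|x| < 1 ->
  zeta x <= 3 / 4 * x ^+ 2 / (1 - `|x|).
Proof.
move=> x1.
have xb : -1 < x < 1 by rewrite -ltr_norml.
pose u := Num.sqrt (1 + x).
have u0 : 0 < u by rewrite sqrtr_gt0; lra.
have xu : x = u ^+ 2 - 1 by rewrite sqr_sqrtr; lra.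
have l : 2 - 2 * u^-1 <= ln (1 + x).
  have := ln_ge1subV u0.
  have -> : 1 + x = u ^+ 2 by rewrite {1}xu; ring.
  by rewrite lnXn // mulr2n; lra.
have z : zeta x <= (u - 1) ^+ 2 * (u + 2) / u.
  have -> : (u - 1) ^+ 2 * (u + 2) / u = x - (2 - 2 * u^-1).
    by rewrite xu; field; rewrite gt_eqF.
  by rewrite /zeta; lra.
apply: le_trans z _.
have -> : 3 / 4 * x ^+ 2 / (1 - `|x|) = (u - 1) ^+ 2 * (3 / 4 * (u + 1) ^+ 2 / (1 - `|x|)).
  by rewrite {1}xu; field; rewrite gt_eqF // subr_gt0.
rewrite -mulrA; apply: ler_wpM2l; first exact: sqr_ge0.
rewrite ler_pdivrMr // mulrAC ler_pdivlMr ?subr_gt0 //.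
have [x0|x0] := leP 0 x.
  rewrite ger0_norm // xu.
  have u1 : 1 <= u by nra.
  have : 0 <= (u - 1) * (u ^+ 2 - 1) by nra.
  nra.
rewrite ltr0_norm // xu.
have u1 : u < 1 by nra.
nra.
Qed.

(** Concavity at the mean m: ln lies below its tangent at m in both points 1 and t, and the weighted
    linear terms cancel. *)
Lemma weighted_amgm_ln theta t : 0 < theta < 1 -> 0 < t ->
  theta * ln t <= ln (1 - theta + theta * t) /\
  (t != 1 -> theta * ln t < ln (1 - theta + theta * t)).
Proof.
move=> /andP[p0 p1] t0; set m := 1 - theta + theta * t.
have m0 : 0 < m by rewrite /m; have := mulr_gt0 p0 t0; lra.
have mE : m = 1 - theta + theta * t by []; clearbody m.
have a : ln t - ln m <= t / m - 1 by rewrite -ln_div ?posrE // ln_lesub1 ?divr_gt0.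
have b : - ln m <= m^-1 - 1 by rewrite -lnV ?posrE // ln_lesub1 ?invr_gt0.
have e : theta * (t / m - 1) + (1 - theta) * (m^-1 - 1) = 0.
  rewrite [LHS](_ : _ = (1 - theta + theta * t) / m - 1).
    by rewrite -mE divff ?subrr ?gt_eqF.
  by field; rewrite gt_eqF.
have a' := ler_wpM2l (ltW p0) a.
split=> [|t1].
  have : (1 - theta) * (- ln m) <= (1 - theta) * (m^-1 - 1) by rewrite ler_pM2l //; lra.
  nra.
have b' : - ln m < m^-1 - 1.
  rewrite -lnV ?posrE //; apply: ln_ltsub1; rewrite ?invr_gt0 // invr_eq1.
  rewrite -subr_eq0 (_ : m - 1 = theta * (t - 1)); last by rewrite mE; ring.
  by rewrite mulf_neq0 ?subr_eq0 // gt_eqF.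
have p1' : 0 < 1 - theta by lra.
have : (1 - theta) * (- ln m) < (1 - theta) * (m^-1 - 1) by rewrite ltr_pM2l.
nra.
Qed.

(* Decrease of the objective along an exact line search towards or away from a
   vertex whose leverage score is [v]. *)
Definition line_search_gain (D v : R) : R :=
  D * ln (v / D) - (D - 1) * ln ((v - 1) / (D - 1)).

Let mul_divrK (D x : R) : 0 < D -> D * ((D - 1) / D * x) = (D - 1) * x.
Proof. by move=> D0; field; rewrite gt_eqF. Qed.

(** Strict AM-GM with weights 1/D and (D - 1)/D at the points 1 and (v - 1)/(D - 1), whose weighted
    mean is v/D. *)
Lemma line_search_gain_gt0 (D v : R) : 1 < D -> 1 < v -> v != D ->
  0 < line_search_gain D v.
Proof.
move=> D1 v1 vD; rewrite /line_search_gain.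
have th : 0 < (D - 1) / D < 1.
  by rewrite divr_gt0 ?ltr_pdivrMr; lra.
have t0 : 0 < (v - 1) / (D - 1) by rewrite divr_gt0; lra.
have [_] := weighted_amgm_ln th t0.
have -> : 1 - (D - 1) / D + (D - 1) / D * ((v - 1) / (D - 1)) = v / D.
  by field; rewrite subr_eq0 !gt_eqF //; lra.
have h : (v - 1) / (D - 1) != 1.
  rewrite -subr_eq0 (_ : _ - 1 = (v - D) / (D - 1)); last by field; lra.
  by rewrite mulf_neq0 ?subr_eq0 // invr_eq0 subr_eq0 gt_eqF.
have D0 : 0 < D by lra.
move=> /(_ h); rewrite -(ltr_pM2l D0) mul_divrK //; lra.
Qed.

Lemma line_search_gain_ge0 (D v : R) : 1 < D -> 1 < v -> 0 <= line_search_gain D v.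
Proof.
move=> D1 v1; have [->|vD] := eqVneq v D; last exact/ltW/line_search_gain_gt0.
by rewrite /line_search_gain !divff ?ln1 ?mulr0 ?subrr // ?subr_eq0 gt_eqF //; lra.
Qed.

(** The product hypothesis places w between D and v on either side, so the gain grows away from D.
    AM-GM is applied at (v - 1)/(w - 1); its mean is at most v/w exactly because that product is
    nonnegative. *)
Lemma line_search_gain_le (D w v : R) : 1 < D -> 1 < w -> 1 < v ->
  0 <= (w - D) * (v - w) -> line_search_gain D w <= line_search_gain D v.
Proof.
move=> D1 w1 v1 h; rewrite /line_search_gain.
have th : 0 < (D - 1) / D < 1.
  by rewrite divr_gt0 ?ltr_pdivrMr; lra.
have t0 : 0 < (v - 1) / (w - 1) by rewrite divr_gt0; lra.
have [+ _] := weighted_amgm_ln th t0.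
set m := 1 - _ + _.
have vw : m <= v / w.
  rewrite -subr_ge0 (_ : _ - _ = (w - D) * (v - w) / (w * D * (w - 1))); last first.
    by rewrite /m; field; rewrite ?subr_eq0 !gt_eqF //; lra.
  by rewrite divr_ge0 // !mulr_ge0 ?subr_ge0; lra.
have m0 : 0 < m.
  have -> : m = (D^-1) + (D - 1) / D * ((v - 1) / (w - 1)).
    by rewrite /m; field; rewrite ?subr_eq0 !gt_eqF //; lra.
  by rewrite addr_gt0 ?invr_gt0 ?mulr_gt0 ?invr_gt0 //; lra.
have lnm : ln m <= ln (v / w) by rewrite ler_ln ?posrE // divr_gt0; lra.
have D0 : 0 < D by lra.
move=> /le_trans/(_ lnm); rewrite -(ler_pM2l D0) mul_divrK //.
have -> : ln (v / w) = ln (v / D) - ln (w / D) by rewrite !ln_div ?posrE; lra.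
have -> : ln ((v - 1) / (w - 1)) = ln ((v - 1) / (D - 1)) - ln ((w - 1) / (D - 1)).
  by rewrite !ln_div ?posrE; lra.
lra.
Qed.

Lemma line_search_gain_bound (D eps : R) : 1 < D -> 0 < eps ->
  exists2 delta, 0 < delta &
    forall v, 1 < v -> eps <= `|v - D| -> delta <= line_search_gain D v.
Proof.
move=> D1 e0.
(* The gain is used only above 1, so the lower comparison point is never taken below the midpoint of
   1 and D. *)
pose w := Num.max (D - eps) ((1 + D) / 2).
have w1 : 1 < w by rewrite lt_max; apply/orP; right; lra.
have wD : w < D by rewrite gt_max; apply/andP; split; lra.
exists (Num.min (line_search_gain D (D + eps)) (line_search_gain D w)).
  by rewrite lt_min !line_search_gain_gt0 //; lra.
move=> v v1 ve; rewrite ge_min; apply/orP.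
have [vD|vD] := leP D v.
  left; rewrite ger0_norm ?subr_ge0 // in ve.
  by apply: line_search_gain_le => //; rewrite ?mulr_ge0 //; lra.
right; rewrite ltr0_norm ?subr_lt0 // in ve.
have vw : v <= w by rewrite le_max; apply/orP; left; lra.
by apply: line_search_gain_le => //; rewrite mulr_le0 //; lra.
Qed.

End ScalarBounds.

(** * The log-determinant objective *)

Section MomentGeometry.
Variables (R : realType) (n d : nat) (A : 'M[R]_(n, d)).
Implicit Types (p q x z : 'cV[R]_n).

(** Sylvester's identity, from two block-triangular factorizations of one matrix. *)
Lemma det_addmx_mulC (m k : nat) (B : 'M[R]_(m, k)) (C : 'M[R]_(k, m)) :
  \det (1%:M + B *m C) = \det (1%:M + C *m B).
Proof.
have e1 : block_mx 1%:M B (- C) 1%:M =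
    block_mx 1%:M 0 (- C) 1%:M *m block_mx 1%:M B 0 (1%:M + C *m B).
  rewrite mulmx_block !mul1mx !mulmx1 !mul0mx !addr0.
  by rewrite mulNmx addrCA addNr addr0.
have e2 : block_mx 1%:M B (- C) 1%:M =
    block_mx 1%:M B 0 1%:M *m block_mx (1%:M + B *m C) 0 (- C) 1%:M.
  rewrite mulmx_block !mul1mx !mulmx1 !mul0mx !add0r.
  by rewrite mulmxN addrK.
have := congr1 determinant e1; rewrite {1}e2 !det_mulmx !det_ublock !det_lblock.
by rewrite !det1 !mul1r mulr1.
Qed.

Lemma moment_is_linear : linear (moment A : 'cV[R]_n -> 'M[R]_d).
Proof.
move=> c x y; rewrite /moment scaler_sumr -big_split /=.
by apply: eq_bigr => i _; rewrite !mxE scalerDl scalerA.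
Qed.
HB.instance Definition _ := GRing.isLinear.Build R 'cV[R]_n 'M[R]_d _ (moment A)
  moment_is_linear.

Lemma moment_sym p : (moment A p)^T = moment A p.
Proof.
rewrite /moment raddf_sum /=; apply: eq_bigr => i _.
by rewrite linearZ /= /rank1 trmx_mul trmxK.
Qed.

Lemma moment_delta i : moment A (delta_mx i 0) = rank1 A i.
Proof.
rewrite /moment (bigD1 i) //= mxE !eqxx scale1r big1 ?addr0 // => j ji.
by rewrite mxE (negPf ji) scale0r.
Qed.

Lemma posdef_unit (M : 'M[R]_d) : posdef M -> M \in unitmx /\ 0 < \det M.
Proof.
move=> pM; have [P [e [uP PM _]]] := simultaneous_diag pM (trmx0 R d d).
have := congr1 determinant PM; rewrite !det_mulmx det_tr det1 => h.
suff dM : 0 < \det M by rewrite unitmxE unitfE gt_eqF.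
have P2 : 0 < \det P ^+ 2.
  by rewrite exprn_even_gt0 //= -unitfE -unitmxE.
rewrite -(pmulr_rgt0 _ P2) (_ : _ * _ = 1) ?ltr01 // -h; ring.
Qed.

(* [grad p x] is minus the derivative of [objective A] at [p] along [x]. *)
Definition grad p x : R := \tr (invmx (moment A p) *m moment A x).

(** The second derivative of [objective A] at [p], kept as a bilinear form on the whole space so
    that one object serves the simplex, the face and its tangent space. *)
Definition hess p x y : R :=
  \tr (invmx (moment A p) *m moment A x *m invmx (moment A p) *m moment A y).

Lemma grad_delta p i : grad p (delta_mx i 0) = leverage A p i 0.
Proof.
by rewrite /grad moment_delta /rank1 mulmxA mxtrace_mulC mulmxA trace_mx11 [RHS]mxE.
Qed.

Lemma hess_delta p i j : hess p (delta_mx i 0) (delta_mx j 0) =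
  (((arow A i)^T *m invmx (moment A p) *m arow A j) 0 0) ^+ 2.
Proof.
set V := invmx _.
have sV : V^T = V by rewrite /V trmx_inv moment_sym.
rewrite /hess !moment_delta -/V /rank1 -!mulmxA mxtrace_mulC -!mulmxA mxtrace_mulC !mulmxA.
set a := arow A i; set b := arow A j.
have -> : a^T *m V *m b *m b^T *m V *m a = (a^T *m V *m b) *m (b^T *m V *m a).
  by rewrite !mulmxA.
by rewrite trace_mx11 mxE big_ord1 (bilinear_formC _ _ sV) expr2.
Qed.

Lemma grad_is_linear p : linear (grad p : 'cV[R]_n -> R^o).
Proof.
by move=> c x y; rewrite /grad linearP mulmxDr mxtraceD -scalemxAr mxtraceZ.
Qed.
HB.instance Definition _ p := GRing.isLinear.Build R 'cV[R]_n R^o _ (grad p)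
  (grad_is_linear p).

Lemma hess_is_linear p x : linear (hess p x : 'cV[R]_n -> R^o).
Proof.
by move=> c y z; rewrite /hess linearP mulmxDr mxtraceD -scalemxAr mxtraceZ.
Qed.
HB.instance Definition _ p x := GRing.isLinear.Build R 'cV[R]_n R^o _ (hess p x)
  (hess_is_linear p x).

Lemma gradD p x y : grad p (x + y) = grad p x + grad p y.
Proof. exact: (raddfD (grad p)). Qed.

Lemma gradB p x y : grad p (x - y) = grad p x - grad p y.
Proof. exact: (raddfB (grad p)). Qed.

Lemma gradZ p c x : grad p (c *: x) = c * grad p x.
Proof. exact: (linearZ_LR (grad p : {linear 'cV[R]_n -> R^o})). Qed.

Lemma hessZr p c x y : hess p x (c *: y) = c * hess p x y.
Proof. exact: (linearZ_LR (hess p x : {linear 'cV[R]_n -> R^o})). Qed.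

Lemma hessC p x y : hess p x y = hess p y x.
Proof. by rewrite /hess -!mulmxA mxtrace_mulC -!mulmxA mxtrace_mulC -!mulmxA. Qed.

Lemma hessZ p c x : hess p (c *: x) (c *: x) = c ^+ 2 * hess p x x.
Proof. by rewrite hessZr hessC hessZr mulrA. Qed.

Lemma colvec_delta_sum x : x = \sum_i x i 0 *: delta_mx i 0.
Proof.
apply/colP => j; rewrite summxE (bigD1 j) //= !mxE !eqxx mulr1 big1 ?addr0 // => i ij.
by rewrite !mxE eq_sym (negPf ij) mulr0.
Qed.

Lemma grad_sum p x : grad p x = \sum_i x i 0 * leverage A p i 0.
Proof.
rewrite {1}(colvec_delta_sum x) raddf_sum /=; apply: eq_bigr => i _.
by rewrite gradZ grad_delta.
Qed.

Lemma grad_id p : posdef (moment A p) -> grad p p = d%:R.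
Proof.
by move=> /posdef_unit[uM _]; rewrite /grad mulVmx // mxtrace1.
Qed.

(* Simultaneous diagonalization of [moment p] and [moment x]: [e] lists the
   relative eigenvalues and [Z z] is [moment z] in the diagonalizing basis. *)
Lemma moment_pencil p x : posdef (moment A p) ->
  exists (e : 'I_d -> R) (Z : 'cV[R]_n -> 'I_d -> 'I_d -> R),
  [/\ forall z k l, Z z k l = Z z l k,
      [/\ forall i k, 0 <= Z (delta_mx i 0) k k, forall k l, Z x k l = e k *+ (k == l),
          forall c z k l, Z (c *: z) k l = c * Z z k l
        & (forall k, e k = 0) -> moment A x = 0],
      forall z, grad p z = \sum_k Z z k k,
      forall z, hess p x z = \sum_k e k * Z z k k
    & [/\ posdef (moment A (p + x)) <-> (forall k, 0 < 1 + e k),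
         \det (moment A (p + x)) = \det (moment A p) * \prod_k (1 + e k)
        & (forall k, 0 < 1 + e k) ->
          (forall z, grad (p + x) z = \sum_k Z z k k / (1 + e k)) /\
          (forall z, hess (p + x) z z =
             \sum_k \sum_l Z z k l ^+ 2 / ((1 + e k) * (1 + e l)))]].
Proof.
move=> pM; have [P [e [uP PM PN]]] := simultaneous_diag pM (moment_sym x).
have [uM dM] := posdef_unit pM.
set M := moment A p in pM PM uM dM *.
pose Z z := P *m moment A z *m P^T.
have uPT : P^T \in unitmx by rewrite unitmx_tr.
have sZ z : (Z z)^T = Z z by rewrite /Z !trmx_mul trmxK moment_sym mulmxA.
have inv (B D : 'M[R]_d) : D *m (P *m B *m P^T) = 1%:M -> invmx B = P^T *m D *m P.
  move=> h; have h' : P^T *m D *m P *m B = 1%:M.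
    apply: (can_inj (mulmxK uPT)).
    have -> : P^T *m D *m P *m B *m P^T = P^T *m (D *m (P *m B *m P^T)).
      by rewrite !mulmxA.
    by rewrite h mulmx1 mul1mx.
  have uB : B \in unitmx by case: (mulmx1_unit h').
  by rewrite -[RHS]mulmx1 -(mulmxV uB) mulmxA h' mul1mx.
have invM : invmx M = P^T *m 1%:M *m P by apply: inv; rewrite PM mulmx1.
have trZ (D : 'M[R]_d) z : \tr (P^T *m D *m P *m moment A z) = \tr (D *m Z z).
  by rewrite /Z -!mulmxA mxtrace_mulC -!mulmxA.
have trZ2 (D : 'M[R]_d) w z :
    \tr (P^T *m D *m P *m moment A w *m (P^T *m D *m P) *m moment A z) =
    \tr (D *m Z w *m D *m Z z).
  by rewrite /Z -!mulmxA mxtrace_mulC -!mulmxA.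
have MN : P *m moment A (p + x) *m P^T = diag_mx (\row_k (1 + e 0 k)).
  rewrite raddfD /= -/M mulmxDr mulmxDl PM PN; apply/matrixP => k l.
  by rewrite !mxE -mulrnDl.
exists (fun k => e 0 k), (fun z k l => Z z k l); split.
- by move=> z k l; rewrite -[in LHS]sZ mxE.
- split=> [i k|k l|c z k l|e0]; last 3 first.
  + by rewrite /Z PN mxE.
  + by rewrite /Z linearZ /= -scalemxAr -scalemxAl mxE.
  + apply: (can_inj (mulKmx uP)); apply: (can_inj (mulmxK uPT)).
    by rewrite PN mulmx0 mul0mx; apply/matrixP => k l; rewrite !mxE e0 mul0rn.
  rewrite /Z moment_delta /rank1 !mulmxA -mulmxA -trmx_mul mxE big_ord1.
  by rewrite [_^T _ _]mxE -expr2 sqr_ge0.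
- by move=> z; rewrite /grad -/M invM trZ mul1mx.
- move=> z; rewrite /hess -/M invM trZ2 !mul1mx mulmx1 [Z x]PN.
  by apply: eq_bigr => k _; rewrite mul_diag_mx mxE.
split.
- split=> [[_ pos] k|pos].
    pose u : 'cV[R]_d := delta_mx k 0.
    have u0 : P^T *m u != 0.
      apply/eqP => /(congr1 (mulmx (invmx P^T))); rewrite mulKmx // mulmx0.
      by move/colP/(_ k)/eqP; rewrite !mxE !eqxx oner_eq0.
    have := pos _ u0; rewrite trmx_mul trmxK.
    rewrite (_ : _ *m _ = u^T *m (P *m moment A (p + x) *m P^T) *m u); last first.
      by rewrite !mulmxA.
    by rewrite MN /u trmx_delta -rowE -colE !mxE eqxx mulr1n.
  split=> [|y y0]; first exact: moment_sym.
  pose u := invmx P^T *m y.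
  have yE : y = P^T *m u by rewrite /u mulKVmx.
  have u0 : u != 0 by apply: contra y0 => /eqP h; rewrite yE h mulmx0.
  clearbody u.
  rewrite yE trmx_mul trmxK.
  rewrite (_ : _ *m _ = u^T *m (P *m moment A (p + x) *m P^T *m u)); last first.
    by rewrite !mulmxA.
  rewrite MN dot_sum.
  have [k uk] : exists k, u k 0 != 0.
    apply/existsP; apply: contraNT u0 => /existsPn h; apply/eqP/colP => k.
    by have := h k; rewrite negbK [RHS]mxE => /eqP.
  rewrite (bigD1 k) //= ltr_pwDl //.
    rewrite mul_diag_mx !mxE mulrCA -expr2 mulr_gt0 // exprn_even_gt0 //.
  apply: sumr_ge0 => l _.
  by rewrite mul_diag_mx !mxE mulrCA -expr2 mulr_ge0 ?sqr_ge0 // ltW.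
- have := congr1 determinant MN; have := congr1 determinant PM.
  rewrite !det_mulmx det_tr det1 det_diag => h1 h2.
  rewrite (eq_bigr (fun k => (\row_k (1 + e 0 k)) 0 k)); last by move=> k _; rewrite mxE.
  rewrite -h2 -[LHS]mul1r -h1; ring.
move=> pos.
pose D : 'M[R]_d := diag_mx (\row_k (1 + e 0 k)^-1).
have invMN : invmx (moment A (p + x)) = P^T *m D *m P.
  apply: inv; rewrite MN; apply/matrixP => k l; rewrite mul_diag_mx !mxE.
  have [->|_] := eqVneq k l; last by rewrite !mulr0n mulr0.
  by rewrite !mulr1n mulVf // gt_eqF.
have DZ (w : 'M[R]_d) k l : (D *m w) k l = (1 + e 0 k)^-1 * w k l.
  by rewrite mul_diag_mx [LHS]mxE [X in X * _]mxE.
split=> z.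
  rewrite /grad invMN trZ; apply: eq_bigr => k _.
  by rewrite DZ mulrC.
rewrite /hess invMN trZ2 -mulmxA; apply: eq_bigr => k _.
rewrite mxE; apply: eq_bigr => l _.
by rewrite !DZ -[in Z z l k]sZ [(Z z)^T _ _]mxE invfM; ring.
Qed.

End MomentGeometry.

(** * Self-concordance estimates in relative eigenvalues *)

Section MomentAnalysis.
Variables (R : realType) (n d : nat) (A : 'M[R]_(n, d)).
Implicit Types (p q x z : 'cV[R]_n).

Lemma Cauchy_Schwarz_sum (I : finType) (a b : I -> R) :
  (\sum_i a i * b i) ^+ 2 <= (\sum_i a i ^+ 2) * (\sum_i b i ^+ 2).
Proof.
set X := \sum_i a i * b i; set B := \sum_i b i ^+ 2; set Y := \sum_i a i ^+ 2.
have h : 0 <= B * (B * Y - X ^+ 2).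
  have -> : B * (B * Y - X ^+ 2) = \sum_i (B * a i - X * b i) ^+ 2.
    rewrite (eq_bigr (fun i => B ^+ 2 * a i ^+ 2 + (- (2 * B * X)) * (a i * b i) +
        X ^+ 2 * b i ^+ 2)); last by move=> i _; ring.
    by rewrite !big_split /= -!mulr_sumr -/X -/B -/Y; ring.
  by rewrite sumr_ge0 // => i _; exact: sqr_ge0.
have [B0|B0] := eqVneq B 0.
  have b0 i : b i = 0.
    have := B0; rewrite /B => /eqP; rewrite psumr_eq0 => [|j _]; last exact: sqr_ge0.
    by move=> /allP /(_ i (mem_index_enum _)); rewrite sqrf_eq0 => /eqP.
  rewrite /X big1 ?expr0n /= ?B0 ?mulr0 // => i _; by rewrite b0 mulr0.
have Bp : 0 < B by rewrite lt_def B0 sumr_ge0 // => i _; exact: sqr_ge0.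
by move: h; rewrite pmulr_rge0 // subr_ge0 mulrC.
Qed.

Lemma ln_prod (I : finType) (a : I -> R) : (forall i, 0 < a i) ->
  ln (\prod_i a i) = \sum_i ln (a i).
Proof.
move=> a0; suff : 0 < \prod_i a i /\ ln (\prod_i a i) = \sum_i ln (a i) by case.
elim/big_rec2: _ => [|i x y _ [x0 <-]]; first by rewrite ln1.
by rewrite mulr_gt0 // lnM ?posrE.
Qed.

Lemma hess_ge0 p x : posdef (moment A p) -> 0 <= hess A p x x.
Proof.
move=> pM; have [e [Z [_ [_ Zx _ _] _ h _]]] := moment_pencil x pM.
rewrite h sumr_ge0 // => k _; rewrite Zx eqxx mulr1n -expr2; exact: sqr_ge0.
Qed.

Lemma hess_eq0 p x : posdef (moment A p) -> hess A p x x = 0 -> moment A x = 0.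
Proof.
move=> pM; have [e [Z [_ [_ Zx _ h0] _ h _]]] := moment_pencil x pM.
rewrite h => /eqP; rewrite psumr_eq0 => [/allP h'|k _]; last first.
  by rewrite Zx eqxx mulr1n -expr2 sqr_ge0.
apply: h0 => k; apply/eqP.
by have := h' k (mem_index_enum _); rewrite Zx eqxx mulr1n mulf_eq0 orbb.
Qed.

Lemma leverage_ge0 p i : posdef (moment A p) -> 0 <= leverage A p i 0.
Proof.
move=> pM; have [e [Z [_ [Zd _ _ _] g _ _]]] := moment_pencil (0 : 'cV_n) pM.
by rewrite -grad_delta g sumr_ge0.
Qed.

Lemma objective_expand p x : posdef (moment A p) -> posdef (moment A (p + x)) ->
  exists e : 'I_d -> R, [/\ forall k, -1 < e k,
    \sum_k e k ^+ 2 = hess A p x x &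
    objective A (p + x) = objective A p - grad A p x + \sum_k zeta (e k)].
Proof.
move=> pM pMx; have [e [Z [_ [_ Zx _ _] g h [pe dt _]]]] := moment_pencil x pM.
have [pos _] := pe; have {}pos := pos pMx.
have Zxk k : Z x k k = e k by rewrite Zx eqxx mulr1n.
exists e; split.
- by move=> k; have := pos k; lra.
- by rewrite h; apply: eq_bigr => k _; rewrite Zxk expr2.
rewrite /objective dt lnM ?posrE ?prodr_gt0 //; last by case: (posdef_unit pM).
have -> : grad A p x = \sum_k e k by rewrite g; apply: eq_bigr => k _; rewrite Zxk.
by rewrite ln_prod // /zeta [X in _ = _ + X]sumrB; ring.
Qed.

Lemma objective_tangent_le p q : posdef (moment A p) -> posdef (moment A q) ->
  objective A p - grad A p (q - p) <= objective A q.
Proof.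
move=> pp pq; have := @objective_expand p (q - p) pp; rewrite subrKC.
move=> /(_ pq) [e [e1 _ ->]]; rewrite lerDl sumr_ge0 // => k _; exact: zeta_ge0.
Qed.

(** The sign of the first-order term lets it be dropped from the expansion, so the entire excess
    bounds the sum of the zeta(e_k); no closeness of [q] to [p] is assumed beforehand. *)
Lemma objective_ball p q r : posdef (moment A p) -> posdef (moment A q) ->
  0 < r -> grad A p (q - p) <= 0 -> objective A q <= objective A p + zeta r ->
  hess A p (q - p) (q - p) <= r ^+ 2.
Proof.
move=> pp pq r0 g h; have := @objective_expand p (q - p) pp; rewrite subrKC.
move=> /(_ pq) [e [e1 <- oE]]; apply: sum_zeta_le => //; lra.
Qed.

Lemma sqr_le_sum (I : finType) (e : I -> R) k : e k ^+ 2 <= \sum_k e k ^+ 2.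
Proof. by rewrite (bigD1 k) //= lerDl sumr_ge0 // => j _; exact: sqr_ge0. Qed.

Lemma abs_le_sum (I : finType) (e : I -> R) r k : 0 <= r ->
  \sum_k e k ^+ 2 <= r ^+ 2 -> `|e k| <= r.
Proof.
move=> r0 h; rewrite -(@ler_pXn2r _ 2) ?nnegrE // real_normK ?num_real //.
exact: le_trans (sqr_le_sum e k) h.
Qed.

(** The Dikin ellipsoid: every 1 + e_k lies in [1 - r, 1 + r], and the score at p + x weights the
    same nonnegative diagonal entries by 1 / (1 + e_k). *)
Lemma leverage_ball p x r : posdef (moment A p) -> 0 <= r < 1 ->
  hess A p x x <= r ^+ 2 ->
  posdef (moment A (p + x)) /\
  forall i, (1 - r) * leverage A (p + x) i 0 <= leverage A p i 0
              <= (1 + r) * leverage A (p + x) i 0.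
Proof.
move=> pM /andP[r0 r1] hr.
have [e [Z [_ [Zd Zx _ _] g h [pe _ gh]]]] := moment_pencil x pM.
have er k : - r <= e k <= r.
  rewrite -ler_norml; apply: abs_le_sum => //; apply: le_trans hr.
  by rewrite h le_eqVlt; apply/orP; left; apply/eqP/eq_bigr => l _; rewrite Zx eqxx mulr1n expr2.
have pos k : 0 < 1 + e k by have /andP[] := er k; lra.
have [{}gh _] := gh pos.
split=> [|i]; first by apply/pe.
rewrite -!grad_delta g gh !mulr_sumr; apply/andP; split; apply: ler_sum => k _.
  rewrite mulrCA ler_piMr // ler_pdivrMr // mul1r.
  by have /andP[] := er k; lra.
rewrite mulrCA ler_peMr // ler_pdivlMr // mul1r.
by have /andP[] := er k; lra.
Qed.

Lemma objective_descent p x s : posdef (moment A p) -> 0 <= s < 1 ->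
  hess A p x x = s ^+ 2 ->
  objective A (p + x) <= objective A p - grad A p x + 3 / 4 * s ^+ 2 / (1 - s).
Proof.
move=> pM s01 hs; have hs' : hess A p x x <= s ^+ 2 by rewrite hs.
have [pMx _] := leverage_ball pM s01 hs'.
have /andP[s0 s1] := s01.
have [e [e1 eh ->]] := objective_expand pM pMx.
have es k : `|e k| <= s by apply: abs_le_sum => //; rewrite eh hs.
rewrite lerD2l -hs -eh mulr_sumr mulr_suml; apply: ler_sum => k _.
have ek := le_lt_trans (es k) s1.
apply: le_trans (zeta_le_quadratic ek) _.
apply: ler_wpM2l; first by rewrite mulr_ge0 ?sqr_ge0.
by rewrite lef_pV2 ?posrE ?subr_gt0 // lerD2l lerN2.
Qed.

(* In the basis diagonalizing [moment p] and [moment x], with relative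
   eigenvalues [e], the residual gradient after the step is
   [sum (1 / (1 + e) - 1 + e) z = sum (e ^ 2) (z / (1 + e))]. *)
Lemma newton_residual p x z : posdef (moment A p) -> hess A p x x < 1 ->
  grad A p z = hess A p x z ->
  grad A (p + x) z ^+ 2 <= hess A p x x ^+ 2 * hess A (p + x) z z.
Proof.
move=> pM h1 gz; have [e [Z [_ [Zd Zx _ _] g h [pe _ gh]]]] := moment_pencil x pM.
have he : hess A p x x = \sum_k e k ^+ 2.
  by rewrite h; apply: eq_bigr => k _; rewrite Zx eqxx mulr1n expr2.
have pos k : 0 < 1 + e k.
  have := le_lt_trans (sqr_le_sum e k) (_ : _ < 1); rewrite -he => /(_ h1).
  by move=> ek; nra.
have [{}g' h'] := gh pos.
have -> : grad A (p + x) z = \sum_k (e k ^+ 2) * (Z z k k / (1 + e k)).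
  rewrite g'.
  have : \sum_k e k * Z z k k - \sum_k Z z k k = 0 by rewrite -h -g gz subrr.
  rewrite -sumrB => E; rewrite -[LHS]addr0 -[X in _ + X]E -big_split /=.
  by apply: eq_bigr => k _; field; rewrite gt_eqF.
apply: le_trans (Cauchy_Schwarz_sum _ _) _.
apply: ler_pM; try by rewrite sumr_ge0 // => k _; exact: sqr_ge0.
  rewrite he [leRHS]expr2 mulr_suml; apply: ler_sum => k _.
  by rewrite [leLHS]expr2 (ler_wpM2l (sqr_ge0 _)) // sqr_le_sum.
rewrite h'; apply: ler_sum => k _; rewrite (bigD1 k) //= exprMn exprVn.
rewrite [(1 + e k) ^+ 2]expr2 lerDl sumr_ge0 // => l _.
by rewrite divr_ge0 ?sqr_ge0 // mulr_ge0 // ltW.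
Qed.

(** * Scaling and rank-one changes of a design *)

Lemma posdefZ (M : 'M[R]_d) c : 0 < c -> posdef M -> posdef (c *: M).
Proof.
move=> c0 [sM pM]; split=> [|x x0]; first by rewrite linearZ /= sM.
by rewrite -scalemxAr -scalemxAl mxE mulr_gt0 // pM.
Qed.

Lemma moment_shift p j a b : a != 0 ->
  moment A (a *: p + b *: delta_mx j 0) =
  a *: moment A (p + (b / a) *: delta_mx j 0).
Proof.
move=> a0; rewrite -linearZ /= scalerDr scalerA mulrCA mulfV // mulr1.
by [].
Qed.

(** The relative eigenvalues of the rank-one change are c z_k, where the z_k are nonnegative and sum
    to the leverage score; each z_k is thus at most that score, which settles both signs of [b]. *)
Lemma posdef_shift p j a b : posdef (moment A p) -> 0 < a ->
  0 < a + b * leverage A p j 0 -> posdef (moment A (a *: p + b *: delta_mx j 0)).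
Proof.
move=> pM a0 ab; rewrite moment_shift ?gt_eqF //; apply: posdefZ => //.
set c := b / a; set x := c *: _.
have cv : 0 < 1 + c * leverage A p j 0.
  have -> : 1 + c * leverage A p j 0 = (a + b * leverage A p j 0) / a.
    by rewrite /c; field; rewrite gt_eqF.
  exact: divr_gt0.
have [e [Z [_ [Zd Zx Zc _] g _ [pe _ _]]]] := moment_pencil x pM.
apply/pe => k.
have -> : e k = c * Z (delta_mx j 0) k k by rewrite -Zc -/x Zx eqxx mulr1n.
have z0 := Zd j k.
have zv : Z (delta_mx j 0) k k <= leverage A p j 0.
  by rewrite -grad_delta g (bigD1 k) //= lerDl sumr_ge0.
by have [c0|c0] := leP 0 c; nra.
Qed.

Lemma moment_factor p j c : posdef (moment A p) ->
  moment A (p + c *: delta_mx j 0) = moment A p *m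
    (1%:M + (c *: (invmx (moment A p) *m arow A j)) *m (arow A j)^T).
Proof.
move=> /posdef_unit[uM _].
rewrite linearD linearZ /= moment_delta mulmxDr mulmx1 -scalemxAl -scalemxAr.
by rewrite !mulmxA mulmxV // mul1mx.
Qed.

Lemma det_shift p j c : posdef (moment A p) ->
  \det (moment A (p + c *: delta_mx j 0)) =
  \det (moment A p) * (1 + c * leverage A p j 0).
Proof.
move=> pM; rewrite moment_factor // det_mulmx det_addmx_mulC det_mx11.
congr (_ * _); rewrite -scalemxAr [LHS]mxE [X in X + _]mxE [X in _ + X]mxE mulr1n.
by rewrite mulmxA [X in _ = _ + _ * X]mxE.
Qed.

(** Factoring out [a] contributes the power d, and the rank-one factor 1 + (b / a) v gives one power
    back, whence d - 1. *)
Lemma objective_shift p j a b : posdef (moment A p) -> 0 < a ->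
  0 < a + b * leverage A p j 0 ->
  objective A (a *: p + b *: delta_mx j 0) =
  objective A p - (d%:R - 1) * ln a - ln (a + b * leverage A p j 0).
Proof.
move=> pM a0 ab; rewrite /objective moment_shift ?gt_eqF // detZ det_shift //.
have -> : 1 + b / a * leverage A p j 0 = (a + b * leverage A p j 0) / a.
  by field; rewrite gt_eqF.
have [_ dM] := posdef_unit pM.
rewrite !lnM ?posrE ?mulr_gt0 ?divr_gt0 ?invr_gt0 ?exprn_gt0 //.
by rewrite lnV ?posrE // lnXn // -mulr_natl; ring.
Qed.

(** Sherman-Morrison; solved for the squared entry, it is the formula that reads the Hessian off
    leverage queries. *)
Lemma leverage_rank1_update p i j : posdef (moment A p) ->
  leverage A (p + delta_mx j 0) i 0 = leverage A p i 0 -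
    (((arow A i)^T *m invmx (moment A p) *m arow A j) 0 0) ^+ 2
      / (1 + leverage A p j 0).
Proof.
move=> pM; have [uM _] := posdef_unit pM.
have v0 := leverage_ge0 j pM.
set M := moment A p in pM uM *; set V := invmx M; set a := arow A j.
set b := arow A i.
have sV : V^T = V by rewrite /V trmx_inv moment_sym.
pose w := V *m a.
have aw : a^T *m w = (leverage A p j 0)%:M.
  apply/matrixP => k l; rewrite !ord1 [RHS]mxE mulr1n [in RHS]mxE -/M -/V.
  by rewrite /w mulmxA.
set s := 1 + leverage A p j 0.
have s0 : s != 0 by rewrite gt_eqF // /s; lra.
have MN : moment A (p + delta_mx j 0) = M + a *m a^T.
  by rewrite linearD /= moment_delta.
have inv : invmx (moment A (p + delta_mx j 0)) = V - s^-1 *: (w *m w^T).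
  have h : moment A (p + delta_mx j 0) *m (V - s^-1 *: (w *m w^T)) = 1%:M.
    rewrite MN mulmxDl !mulmxBr mulmxV // -!scalemxAr.
    have -> : M *m (w *m w^T) = a *m w^T by rewrite /w !mulmxA mulmxV // mul1mx.
    have -> : a *m a^T *m (w *m w^T) = leverage A p j 0 *: (a *m w^T).
      by rewrite mulmxA -(mulmxA a) aw mul_mx_scalar scalemxAl.
    have -> : a *m a^T *m V = a *m w^T by rewrite /w trmx_mul sV mulmxA.
    rewrite -addrA -[X in _ = X]addr0; congr (_ + _).
    rewrite -{2}[a *m w^T]scale1r scalerA -!scaleNr -!scalerDl.
    rewrite (_ : _ + _ = 0) ?scale0r //.
    by rewrite /GRing.scale /=; rewrite /s in s0 *; field.
  have u : moment A (p + delta_mx j 0) \in unitmx by case: (mulmx1_unit h).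
  by rewrite -[LHS]mulmx1 -h mulKmx.
rewrite mxE inv mulmxBr mulmxBl -scalemxAr -scalemxAl.
have -> : b^T *m (w *m w^T) *m b = (b^T *m w) *m (b^T *m w)^T.
  by rewrite (trmx_mul b^T) trmxK !mulmxA.
rewrite [LHS]mxE [X in _ + X]mxE [X in _ - X]mxE [X in _ - _ * X]mxE big_ord1.
rewrite [(b^T *m w)^T _ _]mxE -expr2 mulrC; congr (_ - _ / _).
  by rewrite [RHS]mxE.
by rewrite /w mulmxA.
Qed.

Lemma leverageZ p c i : posdef (moment A p) -> c != 0 ->
  leverage A (c *: p) i 0 = c^-1 * leverage A p i 0.
Proof.
move=> /posdef_unit[uM _] c0; rewrite [LHS]mxE [X in _ * X]mxE linearZ /=.
have -> : invmx (c *: moment A p) = c^-1 *: invmx (moment A p).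
  have h : (c *: moment A p) *m (c^-1 *: invmx (moment A p)) = 1%:M.
    by rewrite -scalemxAr -scalemxAl scalerA mulVf // scale1r mulmxV.
  have u : (c *: moment A p) \in unitmx by case: (mulmx1_unit h).
  by rewrite -[LHS]mulmx1 -h mulKmx.
by rewrite -scalemxAr -scalemxAl [LHS]mxE.
Qed.

End MomentAnalysis.

(** * Away-step Frank-Wolfe *)

Section AwaySteps.
Variables (R : realType) (n d : nat) (A : 'M[R]_(n, d)).
Hypothesis d_gt1 : (1 < d)%N.
Implicit Types (p q x z : 'cV[R]_n).

Let D1 : 1 < d%:R :> R.
Proof. by rewrite ltr1n. Qed.

Let D0 : 0 < d%:R :> R.
Proof. by rewrite ltr0n ltnW. Qed.

Definition spanning_design p : Prop := design p /\ posdef (moment A p).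

Lemma sum_weighted_leverage p : posdef (moment A p) ->
  \sum_i p i 0 * leverage A p i 0 = d%:R.
Proof. by move=> pM; rewrite -grad_sum grad_id. Qed.

Lemma design_exists_gt0 p : design p -> exists i, 0 < p i 0.
Proof.
move=> [p0 p1]; apply/existsP; apply: contraT => /existsPn h; exfalso.
have : \sum_i p i 0 = 0.
  by apply: big1 => i _; apply/eqP; rewrite eq_le p0 andbT leNgt h.
by rewrite p1 => /eqP; rewrite oner_eq0.
Qed.

Lemma max_leverage_ge p j : spanning_design p ->
  (forall i, leverage A p i 0 <= leverage A p j 0) -> d%:R <= leverage A p j 0.
Proof.
move=> [[p0 p1] pM] h; rewrite -(sum_weighted_leverage pM).
apply: le_trans (_ : \sum_i p i 0 * leverage A p j 0 <= _).
  by apply: ler_sum => i _; rewrite ler_wpM2l.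
by rewrite -mulr_suml p1 mul1r.
Qed.

Lemma sum_delta j : \sum_i (delta_mx j 0 : 'cV[R]_n) i 0 = 1.
Proof.
rewrite (bigD1 j) //= big1 => [|i ij]; first by rewrite mxE !eqxx addr0.
by rewrite mxE (negPf ij).
Qed.

Lemma design_shift p j a b : design p -> a + b = 1 -> 0 <= a ->
  0 <= a * p j 0 + b -> design (a *: p + b *: delta_mx j 0).
Proof.
move=> [p0 p1] ab a0 aj; split=> [i|].
  rewrite !mxE eqxx andbT; have [->|ij] := eqVneq i j; first by rewrite mulr1.
  by rewrite mulr0 addr0 mulr_ge0.
rewrite -ab; under eq_bigr do rewrite mxE [X in X + _]mxE [X in _ + X]mxE.
by rewrite big_split /= -!mulr_sumr p1 sum_delta !mulr1.
Qed.

Lemma supp_shift p j a b : supp (a *: p + b *: delta_mx j 0) \subset j |: supp p.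
Proof.
apply/fintype.subsetP => i; rewrite !inE !mxE eqxx andbT.
have [//|ij] := eqVneq i j; rewrite mulr0 addr0.
by apply: contra => /eqP ->; rewrite mulr0.
Qed.

Lemma toward_step p j (v := leverage A p j 0)
    (g := (v - d%:R) / (d%:R * (v - 1))) (q := (1 - g) *: p + g *: delta_mx j 0) :
  spanning_design p -> d%:R <= v ->
  [/\ spanning_design q,
      objective A q = objective A p - line_search_gain d%:R v
    & supp q \subset j |: supp p].
Proof.
move=> [dp pM] dv; have d1 := D1; have d0 := D0.
have v1 : 0 < v - 1 by lra.
(* With exact line search both arguments of the logarithms in the objective change become quotients
   of v/d and (v - 1)/(d - 1), which add up to the gain. *)
have e1 : 1 - g = v / d%:R / ((v - 1) / (d%:R - 1)).
  by rewrite /g; field; rewrite ?subr_eq0 !gt_eqF //; lra.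
have e2 : (1 - g) + g * v = v / d%:R.
  by rewrite /g; field; rewrite ?subr_eq0 !gt_eqF //; lra.
have g0 : 0 <= g by rewrite /g divr_ge0 ?subr_ge0 // mulr_ge0 // ltW.
have p1 : 0 < (v - 1) / (d%:R - 1) by rewrite divr_gt0 //; lra.
have p2 : 0 < v / d%:R by rewrite divr_gt0 //; lra.
have p3 : 0 < 1 - g by rewrite e1 divr_gt0.
split; last exact: supp_shift.
- split; last by apply: posdef_shift => //; rewrite -/v e2.
  apply: design_shift => //; [by rewrite subrK|exact: ltW|].
  by have [p0 _] := dp; rewrite addr_ge0 // mulr_ge0 // ltW.
- rewrite /q objective_shift // -/v e2 // e1 ln_div ?posrE //.
  by rewrite /line_search_gain; ring.
Qed.

Lemma away_step p j (v := leverage A p j 0)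
    (g := away_stepsize d (p j 0) v) (q := (1 + g) *: p - g *: delta_mx j 0) :
  spanning_design p -> 0 < p j 0 -> v < d%:R ->
  [/\ spanning_design q, supp q \subset supp p &
      (1 < v /\ objective A q = objective A p - line_search_gain d%:R v) \/
      (j \notin supp q /\ objective A q <= objective A p)].
Proof.
move=> [dp pM] pj vd; have d1 := D1; have d0 := D0.
have qE : q = (1 + g) *: p + (- g) *: delta_mx j 0 by rewrite scaleNr.
(* If all mass sat on j, the weighted average of the scores, which is d, would be v itself. *)
have pj1 : p j 0 < 1.
  have [p0 p1] := dp; rewrite ltNge; apply/negP => h.
  have pj0 i : i != j -> p i 0 = 0.
    move=> ij; apply/eqP; rewrite eq_le p0 andbT.
    have : \sum_(k | k != j) p k 0 <= 0 by move: p1; rewrite (bigD1 j) //=; lra.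
    by apply: le_trans; rewrite (bigD1 i) //= lerDl sumr_ge0.
  have := sum_weighted_leverage pM; rewrite (bigD1 j) //= -/v big1 ?addr0; last first.
    by move=> i ij; rewrite pj0 // mul0r.
  have -> : p j 0 = 1 by move: p1; rewrite (bigD1 j) //= big1 ?addr0.
  by rewrite mul1r => vE; rewrite vE ltxx in vd.
have v0 : 0 <= v by exact: leverage_ge0.
set gmax := p j 0 / (1 - p j 0).
have gm0 : 0 < gmax by rewrite divr_gt0 // subr_gt0.
set gopt := (d%:R - v) / (d%:R * (v - 1)).
have gE : g = if 1 < v then Num.min gopt gmax else gmax by [].
have go0 : 1 < v -> 0 < gopt.
  by move=> v1; rewrite divr_gt0 ?mulr_gt0 ?subr_gt0.
have gopt1 : 1 < v -> gopt * (v - 1) = 1 - v / d%:R.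
  by move=> v1; rewrite /gopt; field; rewrite ?subr_eq0 !gt_eqF.
have g0 : 0 < g.
  by rewrite gE; case: ifP => // v1; rewrite lt_min go0.
have gm : g <= gmax by rewrite gE; case: ifP => // v1; rewrite ge_min lexx orbT.
have gle : 1 < v -> g <= gopt by move=> v1; rewrite gE v1 ge_min lexx.
have gv : 0 < 1 + g + - g * v.
  have [v1|v1] := ltP 1 v; last by nra.
  have := gopt1 v1; have := gle v1.
  have : 0 < v / d%:R by rewrite divr_gt0 //; lra.
  by nra.
have qj : 0 <= (1 + g) * p j 0 + - g.
  have : g * (1 - p j 0) <= p j 0 by rewrite -ler_pdivlMr ?subr_gt0.
  lra.
clearbody q; subst q.
have dq : design ((1 + g) *: p + (- g) *: delta_mx j 0).
  by apply: design_shift => //; [rewrite addrK|lra].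
split.
- by split=> //; apply: posdef_shift => //; lra.
- apply: fintype.subset_trans (supp_shift p j (1 + g) (- g)) _.
  by rewrite finset.subUset finset.sub1set inE gt_eqF //=.
- have oE := objective_shift (j := j) (a := 1 + g) (b := - g) pM.
  have g1 : 0 < 1 + g by lra.
  move: oE => /(_ g1); rewrite -/v => /(_ gv) oE.
  have [/andP[v1 ggo]|ng] := boolP ((1 < v) && (g == gopt)).
    left; split=> //; move: oE; rewrite (eqP ggo).
    have -> : 1 + gopt + - gopt * v = v / d%:R by rewrite mulNr; have := gopt1 v1; lra.
    have -> : 1 + gopt = v / d%:R / ((v - 1) / (d%:R - 1)).
      by rewrite /gopt; field; rewrite ?subr_eq0 !gt_eqF //; lra.
    have w0 : 0 < v / d%:R by rewrite divr_gt0 //; lra.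
    have w1 : 0 < (v - 1) / (d%:R - 1) by rewrite divr_gt0 // subr_gt0.
    move=> ->; rewrite (ln_div w0 w1) /line_search_gain; ring.
  right.
  have gmE : g = gmax.
    move: ng; rewrite gE; case: ifP => //= v1.
    by rewrite minElt; case: ifP => //; rewrite eqxx.
  split.
    rewrite inE negbK !mxE !eqxx mulr1 gmE /gmax; apply/eqP; field.
    by rewrite subr_eq0 gt_eqF.
  rewrite oE.
  (* A truncated step does not overshoot: after ln u >= 1 - 1/u the sum carries the factor gopt - g
     >= 0. For v <= 1 both logarithms are nonnegative. *)
  suff : 0 <= (d%:R - 1) * ln (1 + g) + ln (1 + g + - g * v) by lra.
  have [v1|v1] := ltP 1 v; last first.
    by rewrite addr_ge0 // ?mulr_ge0 ?ln_ge0 //; nra.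
  have l1 := ln_ge1subV g1; have l2 := ln_ge1subV gv.
  have dd : 0 <= d%:R - 1 :> R by lra.
  have l3 := ler_wpM2l dd l1.
  apply: le_trans (lerD l3 l2).
  have -> : (d%:R - 1) * (1 - (1 + g)^-1) + (1 - (1 + g + - g * v)^-1) =
     g * d%:R * (v - 1) * (gopt - g) / ((1 + g) * (1 + g + - g * v)).
    rewrite /gopt; field; rewrite ?subr_eq0 ?mulNr !gt_eqF //; last by lra.
  rewrite divr_ge0 ?mulr_ge0 ?subr_ge0 ?gle //; lra.
Qed.

(** Optimality conditions from the algorithm's own step: a score above d would make a toward step
    strictly decrease the objective. *)
Lemma optimal_leverage_le ps i : optimal_design A ps -> leverage A ps i 0 <= d%:R.
Proof.
move=> [dp pM opt]; rewrite leNgt; apply/negP => vi.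
have [[dq qM] oE _] := toward_step (j := i) (conj dp pM) (ltW vi).
have := opt _ dq qM; rewrite oE.
have := @line_search_gain_gt0 _ d%:R (leverage A ps i 0) D1.
by move=> /(_ (lt_trans D1 vi) (negbT (gt_eqF vi))); lra.
Qed.

Lemma away_step_update_cases p q : spanning_design p ->
  away_step_update d (leverage A) p q ->
  spanning_design q /\ exists jp jm : 'I_n,
    let v := leverage A p in
    [/\ forall i, v i 0 <= v jp 0, d%:R <= v jp 0,
        0 < p jm 0 /\ (forall i, 0 < p i 0 -> v jm 0 <= v i 0)
      & [\/ [/\ d%:R - v jm 0 <= v jp 0 - d%:R,
              objective A q = objective A p - line_search_gain d%:R (v jp 0)
            & supp q \subset jp |: supp p],
           [/\ v jp 0 - d%:R < d%:R - v jm 0, supp q \subset supp p, 1 < v jm 0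
            & objective A q = objective A p - line_search_gain d%:R (v jm 0)]
         | [/\ v jp 0 - d%:R < d%:R - v jm 0, supp q \subset supp p,
              jm \notin supp q & objective A q <= objective A p]]].
Proof.
move=> sp [jp [jm [hp [m0 hm] ->]]]; have d1 := D1.
have vp := max_leverage_ge sp hp.
case: leP => h.
  have [sq oE su] := toward_step sp vp; split=> //.
  by exists jp, jm; split=> //; constructor 1.
have vm : leverage A p jm 0 < d%:R by lra.
have [sq su oE] := away_step sp m0 vm; split=> //.
exists jp, jm; split=> //; case: oE => [[v1 oE]|[v1 oE]].
  by constructor 2.
by constructor 3.
Qed.

Lemma away_step_update_exists p : spanning_design p ->
  exists q, away_step_update d (leverage A) p q.
Proof.
move=> [dp pM]; have [i0 pi0] := design_exists_gt0 dp.
case: (@Order.TotalTheory.arg_maxP _ _ _ i0 predT (fun i => leverage A p i 0)) => // jp _ hp.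
case: (@Order.TotalTheory.arg_minP _ _ _ i0 (fun i => 0 < p i 0)
  (fun i => leverage A p i 0)) => // jm m0 hm.
eexists; exists jp, jm; split; [|split|reflexivity] => // i; exact: hp.
Qed.

End AwaySteps.

(** * Convergence of the loop and identification of the face *)

Section AwayConvergence.
Variables (R : realType) (n d : nat) (A : 'M[R]_(n, d)) (ps : 'cV[R]_n).
Hypotheses (d_gt1 : (1 < d)%N) (ps_opt : optimal_design A ps).
Implicit Types (q x : 'cV[R]_n) (p : nat -> 'cV[R]_n).

(** The tangent plane of the convex objective at [q], evaluated at [ps]: the slope is d along [q]
    and at most d + c along [ps]. *)
Lemma duality_gap q (c : R) : spanning_design A q ->
  (forall i, leverage A q i 0 <= d%:R + c) ->
  objective A q <= objective A ps + c.
Proof.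
move=> [_ qM] h; have [[p0 p1] pM _] := ps_opt.
have := objective_tangent_le qM pM; rewrite gradB grad_id // grad_sum.
have : \sum_i ps i 0 * leverage A q i 0 <= \sum_i ps i 0 * (d%:R + c).
  by apply: ler_sum => i _; rewrite ler_wpM2l.
by rewrite -mulr_suml p1 mul1r; lra.
Qed.

Lemma sublevel_ball q r : posdef (moment A q) -> 0 < r ->
  grad A ps (q - ps) <= 0 ->
  objective A q <= objective A ps + zeta r ->
  hess A ps (q - ps) (q - ps) <= r ^+ 2.
Proof. by case: ps_opt => _ pM _ qM r0 g h; exact: objective_ball. Qed.

Lemma sublevel_leverage q r : posdef (moment A q) -> 0 < r < 1 ->
  grad A ps (q - ps) <= 0 ->
  objective A q <= objective A ps + zeta r -> forall i,
  (1 - r) * leverage A q i 0 <= leverage A ps i 0 <= (1 + r) * leverage A q i 0.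
Proof.
move=> qM /andP[r0 r1] g h; have hb := sublevel_ball qM r0 g h.
have [_ pM _] := ps_opt; have r01 : 0 <= r < 1 by rewrite ltW.
by have [_] := leverage_ball pM r01 hb; rewrite subrKC.
Qed.

Lemma grad_design_le0 q : design q -> grad A ps (q - ps) <= 0.
Proof.
move=> [q0 q1]; have [_ pM _] := ps_opt.
rewrite gradB grad_id // grad_sum subr_le0.
apply: le_trans (_ : \sum_i q i 0 * d%:R <= _).
  apply: ler_sum => i _; apply: ler_wpM2l => //; exact: optimal_leverage_le.
by rewrite -mulr_suml q1 mul1r.
Qed.

Lemma away_iterates_spanning p : spanning_design A (p 0%N) ->
  (forall k, away_step_update d (leverage A) (p k) (p k.+1)) ->
  forall k, spanning_design A (p k).
Proof.
move=> p0 st; elim=> [//|k IH].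
by have [] := away_step_update_cases d_gt1 IH (st k).
Qed.

Section Iterates.
Variable p : nat -> 'cV[R]_n.
Hypotheses (p_span : forall k, spanning_design A (p k))
  (p_step : forall k, away_step_update d (leverage A) (p k) (p k.+1)).

Let f k := objective A (p k).

Let D1 : 1 < d%:R :> R.
Proof. by rewrite ltr1n. Qed.

Lemma objective_nonincreasing k l : (k <= l)%N -> f l <= f k.
Proof.
move=> kl; rewrite -(subnKC kl); elim: (l - k)%N => [|i IH]; first by rewrite addn0.
rewrite addnS; apply: le_trans IH; move: {l kl}(k + i)%N => {}k.
have [_ [jp [jm [hp vp _ [[_ oE _]|[_ _ v1 oE]|[_ _ _ oE]]]]]] :=
  away_step_update_cases d_gt1 (p_span k) (p_step k) => //.
  by rewrite /f oE gerBl line_search_gain_ge0 //; exact: lt_le_trans D1 vp.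
by rewrite /f oE gerBl line_search_gain_ge0.
Qed.

Lemma objective_ge_opt k : objective A ps <= f k.
Proof. by have [_ _ h] := ps_opt; have [dk pk] := p_span k; exact: h. Qed.

Definition drop_step k := exists j, [/\ j \in supp (p k),
  supp (p k.+1) \subset supp (p k) & j \notin supp (p k.+1)].

Lemma drop_step_card k : drop_step k -> (#|supp (p k.+1)| < #|supp (p k)|)%N.
Proof.
move=> [j [jk sub jk1]]; apply: proper_card; rewrite properE sub.
by apply/fintype.subsetPn; exists j.
Qed.

Lemma not_drop_step_cofinal K : exists2 k, (K <= k)%N & ~ drop_step k.
Proof.
apply: contrapT => h.
have hd k : (K <= k)%N -> drop_step k.
  by move=> Kk; apply: contrapT => nd; apply: h; exists k.
have : forall i, (#|supp (p (K + i))| + i <= #|supp (p K)|)%N.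
  elim=> [|i IH]; first by rewrite !addn0.
  apply: leq_trans IH; rewrite addnS -addSn leq_add2r addnS.
  by apply/drop_step_card/hd/leq_addr.
by move=> /(_ #|supp (p K)|.+1); rewrite addnS leqNgt ltnS leq_addl.
Qed.

Lemma objective_eventually_step_small (e : R) : 0 < e ->
  exists K, forall k, (K <= k)%N -> f k - f k.+1 < e.
Proof.
move=> e0.
pose E := [set f k | k in setT]%classic.
have hE : has_inf E.
  split; first by exists (f 0%N), 0%N.
  by exists (objective A ps) => _ [k _ <-]; exact: objective_ge_opt.
have [_ [K _ <-] hK] := inf_adherent e0 hE.
exists K => k Kk.
have h1 := objective_nonincreasing Kk.
have h2 : inf E <= f k.+1 by apply: ge_inf; [exact: hE.2|exists k.+1].
lra.
Qed.

(** One late step that drops no vertex is enough. Its gain is below [delta], so the score it uses is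
    within e of d; in the away case the branch condition transfers this to the largest score. The
    duality gap bounds the excess there, and monotonicity carries the bound on. *)
Lemma objective_cvg (e : R) : 0 < e ->
  exists K, forall k, (K <= k)%N -> f k <= objective A ps + e.
Proof.
move=> e0; have [delta d0 hd] := line_search_gain_bound D1 e0.
have [K hK] := objective_eventually_step_small d0.
have [k Kk nd] := not_drop_step_cofinal K.
exists k => l /objective_nonincreasing /le_trans; apply.
apply: duality_gap => // i.
have [_ [jp [jm [hp vp [m0 hm] c]]]] :=
  away_step_update_cases d_gt1 (p_span k) (p_step k).
have small := hK _ Kk.
have gsmall v : 1 < v -> f k.+1 = f k - line_search_gain d%:R v -> `|v - d%:R| < e.
  move=> v1 fE; rewrite ltNge; apply/negP => /(hd _ v1); rewrite fE in small; lra.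
apply: le_trans (hp i) _.
case: c => [[_ oE _]|[h _ v1 oE]|[h su jm' oE]].
- have := gsmall _ (lt_le_trans D1 vp) oE; rewrite ltr_norml; lra.
- have := gsmall _ v1 oE; rewrite ltr_norml; lra.
- by case: nd; exists jm; split=> //; rewrite inE gt_eqF.
Qed.

Lemma leverage_cvg (e : R) : 0 < e -> exists K, forall k, (K <= k)%N ->
  forall i, `|leverage A (p k) i 0 - leverage A ps i 0| <= e.
Proof.
(* r <= 1/2 bounds the scores of the iterate by 2d, and their error, at most r times the score, by
   2dr <= e. *)
move=> e0; pose r := Num.min 2^-1 (e / (2 * d%:R)).
have d0 : 0 < d%:R :> R by have := D1; lra.
have r0 : 0 < r by rewrite lt_min invr_gt0 ltr0n /= divr_gt0 // mulr_gt0.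
have r2 : r <= 2^-1 by rewrite ge_min lexx.
have rE : r * (2 * d%:R) <= e.
  by rewrite -ler_pdivlMr ?mulr_gt0 // ge_min lexx orbT.
have r01 : 0 < r < 1 by rewrite r0; lra.
have [K hK] := objective_cvg (zeta_gt0 r0).
exists K => k /hK fk i; have [dk pk] := p_span k.
have /andP[h1 h2] := sublevel_leverage pk r01 (grad_design_le0 dk) fk i.
have vd := optimal_leverage_le d_gt1 i ps_opt.
have v0 := leverage_ge0 i pk.
rewrite ler_norml; nra.
Qed.

Lemma support_identified (S : {set 'I_n}) (c : R) : 0 < c ->
  (forall i, i \in S -> leverage A ps i 0 = d%:R) ->
  (forall i, i \notin S -> leverage A ps i 0 <= d%:R - c) ->
  exists K, forall k, (K <= k)%N -> supp (p k) \subset S.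
Proof.
move=> c0 hS hN.
have c2 : 0 < c / 2 by lra.
have c4 : 0 < c / 4 by lra.
have [delta d0 hd] := line_search_gain_bound D1 c2.
have [K1 hK1] := objective_eventually_step_small d0.
have [K2 hK2] := leverage_cvg c4.
pose K := maxn K1 K2.
have facts k : (K <= k)%N -> [/\ f k - f k.+1 < delta,
    forall i, i \in S -> `|leverage A (p k) i 0 - d%:R| <= c / 4 &
    forall i, i \notin S -> leverage A (p k) i 0 <= d%:R - 3 / 4 * c].
  rewrite geq_max => /andP[/hK1 h1 /hK2 h2]; split=> // i iS.
    by have := h2 i; rewrite hS.
  by have := h2 i; have := hN i iS; rewrite ler_norml; lra.
have jpS k jp : (K <= k)%N -> d%:R <= leverage A (p k) jp 0 -> jp \in S.
  move=> /facts [_ _ h] vp; apply: contraT => /h; lra.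
have stay k : (K <= k)%N -> supp (p k) \subset S -> supp (p k.+1) \subset S.
  move=> Kk sk.
  have [_ [jp [jm [_ vp _ [[_ _ su]|[_ su _ _]|[_ su _ _]]]]]] :=
    away_step_update_cases d_gt1 (p_span k) (p_step k).
  - apply: fintype.subset_trans su _.
    by rewrite finset.subUset finset.sub1set sk (jpS k).
  - exact: fintype.subset_trans su sk.
  - exact: fintype.subset_trans su sk.
(* While an off-face vertex carries weight, v_- <= d - 3c/4 and v_+ <= d + c/4 select the away
   branch. An untruncated step would gain [delta], too much, and on-face scores are at least d -
   c/4, so the dropped vertex lies off the face. *)
have drop k : (K <= k)%N -> ~~ (supp (p k) \subset S) ->
    (#|supp (p k.+1) :\: S| < #|supp (p k) :\: S|)%N.
  move=> Kk /fintype.subsetPn[i ik iS]; have [small hin hout] := facts k Kk.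
  have [[p0 _] _] := p_span k.
  have pi : 0 < p k i 0 by rewrite lt_def p0 andbT; move: ik; rewrite inE.
  have [_ [jp [jm [_ vp [m0 hm] c']]]] :=
    away_step_update_cases d_gt1 (p_span k) (p_step k).
  have vi := hout i iS; have vm := hm i pi.
  have := hin _ (jpS k jp Kk vp); rewrite ler_norml => /andP[_ vp'].
  case: c' => [[h _ _]|[h _ v1 oE]|[h su jm' oE]]; first by exfalso; lra.
    exfalso; have : c / 2 <= `|leverage A (p k) jm 0 - d%:R|.
      by rewrite ler0_norm; lra.
    by move=> /(hd _ v1); rewrite /f oE in small; lra.
  have jmS : jm \notin S.
    by apply/negP => /hin; rewrite ler_norml; lra.
  apply: proper_card; rewrite properE; apply/andP; split.
    exact: finset.setSD.
  by apply/fintype.subsetPn; exists jm; rewrite finset.in_setD ?jmS //= inE gt_eqF.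
have reach m : forall k, (K <= k)%N -> (#|supp (p k) :\: S| <= m)%N ->
    exists2 l, (K <= l)%N & supp (p l) \subset S.
  elim: m => [|m IH] k Kk hm; have [sk|sk] := boolP (supp (p k) \subset S);
    try by exists k.
  - by have := drop _ Kk sk; rewrite ltnNge (leq_trans hm).
  - by apply: (IH k.+1) (leqW Kk) _; rewrite -ltnS (leq_trans (drop _ Kk sk)).
have [l Kl sl] := reach _ K (leqnn K) (leqnn _).
exists l => k lk; rewrite -(subnKC lk).
elim: (k - l)%N => [|i IH]; first by rewrite addn0.
by rewrite addnS; apply: stay => //; rewrite (leq_trans Kl) // leq_addr.
Qed.

End Iterates.
End AwayConvergence.

(** * Volumetric initialization *)

Section VolumetricInit.
Variables (R : realType) (n d : nat) (A : 'M[R]_(n, d)).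
Hypotheses (rankA : \rank A = d) (d_gt0 : (0 < d)%N).

Let along (b : 'cV[R]_d) (i : 'I_n) : R := (b^T *m arow A i) 0 0.

Lemma moment_form (p : 'cV[R]_n) (x : 'cV[R]_d) :
  (x^T *m moment A p *m x) 0 0 = \sum_i p i 0 * along x i ^+ 2.
Proof.
rewrite /moment mulmx_sumr mulmx_suml summxE; apply: eq_bigr => i _.
rewrite -scalemxAr -scalemxAl mxE; congr (_ * _).
have -> : x^T *m rank1 A i *m x = (x^T *m arow A i) *m (x^T *m arow A i)^T.
  by rewrite [(x^T *m arow A i)^T]trmx_mul (trmxK x) /rank1 !mulmxA.
by rewrite [LHS]mxE big_ord1 /along expr2; congr (_ * _); rewrite mxE.
Qed.

Lemma along_eq0 (b : 'cV[R]_d) : (forall i, along b i = 0) -> b = 0.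
Proof.
move=> h; have /row_fullP[B BA] : row_full A by rewrite /row_full rankA.
rewrite -[b]mul1mx -BA -mulmxA; have -> : A *m b = 0; last exact: mulmx0.
apply/colP => i; rewrite [RHS]mxE -(h i) /along dotC /arow trmxK -row_mul.
by rewrite [RHS]mxE.
Qed.

Lemma volumetric_init_spanning (p : 'cV[R]_n) :
  volumetric_init A p -> spanning_design A p.
Proof.
move=> [b [hi [lo [top [bP hP tP ->]]]]].
set T := _ :|: _.
have T0 : (0 < #|T|)%N.
  apply/card_gt0P; exists (hi (Ordinal d_gt0)).
  by rewrite inE; apply/orP; left; apply/finset.imsetP; exists (Ordinal d_gt0).
have Tr : 0 < #|T|%:R :> R by rewrite ltr0n.
split.
  split=> [i|]; first by rewrite mxE divr_ge0 ?ler0n.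
  under eq_bigr do rewrite mxE; rewrite -mulr_suml.
  have -> : \sum_i (i \in T)%:R = #|T|%:R :> R.
    by rewrite -sum1_card natr_sum [RHS]big_mkcond; apply: eq_bigr => i _; case: ifP.
  by rewrite divff // gt_eqF.
split=> [|x x0]; first exact: moment_sym.
rewrite moment_form.
(* A zero extremal value would make the direction orthogonal to every row, against full rank. *)
have tt k : along (b k) (top k) != 0.
  apply/eqP => h; have [/negP b0 _] := bP k; apply: b0; apply/eqP/along_eq0 => i.
  by have [_ /(_ i)] := tP k; rewrite -/(along _ _) -/(along _ _) h normr0 normr_le0 => /eqP.
have [k xk] : exists k, along x (top k) != 0.
  apply/existsP; apply: contraNT x0 => /existsPn h.
  (* The pairings of directions with top rows form a triangular matrix with nonzero diagonal, so the
     top rows span the space and [x] cannot be orthogonal to all of them. *)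
  pose B := \matrix_(k < d) (b k)^T.
  pose C := \matrix_(l < d) (arow A (top l))^T.
  have W k l : (B *m C^T) k l = along (b k) (top l).
    by rewrite /along !mxE; apply: eq_bigr => j _; rewrite !mxE.
  have dW : \det (B *m C^T) != 0.
    rewrite -det_tr det_trig.
      by apply/prodf_neq0 => k _; rewrite [X in X != _]mxE W.
    apply/is_trig_mxP => i j ij; rewrite [LHS]mxE W.
    by have [_] := bP j; apply.
  have uC : C \in unitmx.
    by rewrite unitmxE unitfE -det_tr; move: dW; rewrite det_mulmx mulf_eq0 negb_or => /andP[].
  apply/eqP; rewrite -[x]mul1mx -(mulVmx uC) -mulmxA.
  have -> : C *m x = 0; last exact: mulmx0.
  apply/colP => l; have := h l; rewrite negbK /along dotC => /eqP hl; rewrite [RHS]mxE -hl.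
  by rewrite !mxE; apply: eq_bigr => j _; rewrite !mxE.
have kT : top k \in T.
  have [+ _] := tP k; rewrite !inE => /orP[]/eqP ->; apply/orP; [left|right];
  by apply/finset.imsetP; exists k.
rewrite (bigD1 (top k)) //= ltr_pwDl //.
  by rewrite mxE kT mul1r mulr_gt0 ?invr_gt0 // exprn_even_gt0.
by apply: sumr_ge0 => i _; rewrite mxE mulr_ge0 ?sqr_ge0 // divr_ge0 ?ler0n.
Qed.

Lemma orthogonal_direction (s : seq 'I_n) : (size s < d)%N ->
  exists2 b : 'cV[R]_d, b != 0 & forall i, i \in s -> along b i = 0.
Proof.
move=> sd; pose C := \matrix_(k < size s) row (tnth (in_tuple s) k) A.
have : kermx C^T != 0.
  rewrite -mxrank_eq0 mxrank_ker -lt0n subn_gt0; apply: leq_ltn_trans sd.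
  exact: rank_leq_col.
case/rowV0Pn => v /sub_kermxP vC v0; exists v^T.
  by apply: contra v0 => /eqP /(congr1 trmx); rewrite trmxK trmx0 => ->.
move=> i /(tnthP (in_tuple s)) [k ->].
have := congr1 (fun M : 'rV_(size s) => M 0 k) vC; rewrite [RHS]mxE => <-.
by rewrite /along trmxK !mxE; apply: eq_bigr => j _; rewrite !mxE.
Qed.

Lemma extremal_rows (i0 : 'I_n) (b : 'cV[R]_d) : exists hi lo top : 'I_n,
  [/\ forall i, along b lo <= along b i <= along b hi,
      top \in [:: hi; lo] & forall i, `|along b i| <= `|along b top|].
Proof.
case: (@Order.TotalTheory.arg_maxP _ _ _ i0 predT (along b)) => // hi _ hhi.
case: (@Order.TotalTheory.arg_minP _ _ _ i0 predT (along b)) => // lo _ hlo.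
have h i : along b lo <= along b i <= along b hi.
  by apply/andP; split; [exact: hlo|exact: hhi].
exists hi, lo, (if `|along b lo| <= `|along b hi| then hi else lo); split=> //.
  by case: ifP; rewrite !inE eqxx ?orbT.
move=> i; have /andP[h1 h2] := h i.
case: (leP `|along b lo| `|along b hi|) => hl /=; move: hl;
  case: (ger0P (along b lo)); case: (ger0P (along b hi));
  case: (ger0P (along b i)) => *; lra.
Qed.

Lemma volumetric_init_exists (i0 : 'I_n) : exists p, volumetric_init A p.
Proof.
(* [F] sends the list of points found so far to the next direction and rows; on lists of length at
   least d it takes an arbitrary default value. *)
have /choice[F hF] : forall s : seq 'I_n, exists y : 'cV[R]_d * ('I_n * 'I_n * 'I_n),
    (size s < d)%N ->
    [/\ y.1 != 0, forall i, i \in s -> along y.1 i = 0,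
      forall i, along y.1 y.2.1.2 <= along y.1 i <= along y.1 y.2.1.1,
      y.2.2 \in [:: y.2.1.1; y.2.1.2] &
      forall i, `|along y.1 i| <= `|along y.1 y.2.2|].
  move=> s; case: (ltnP (size s) d) => sd; last by exists (0, (i0, i0, i0)).
  have [b b0 bs] := orthogonal_direction sd.
  by have [hi [lo [top [h1 h2 h3]]]] := extremal_rows i0 b; exists (b, (hi, lo, top)).
pose fix S k := if k is k'.+1 then rcons (S k') (F (S k')).2.2 else [::].
have sS k : size (S k) = k by elim: k => //= k IH; rewrite size_rcons IH.
have mS k l : (l < k)%N -> (F (S l)).2.2 \in S k.
  elim: k => //= k IH; rewrite ltnS leq_eqVlt mem_rcons inE.
  by case/predU1P => [->|/IH ->]; rewrite ?eqxx ?orbT.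
have hS (k : 'I_d) := hF (S k) (eq_ind_r (fun m => (m < d)%N) (ltn_ord k) (sS k)).
pose hi (k : 'I_d) := (F (S k)).2.1.1; pose lo (k : 'I_d) := (F (S k)).2.1.2.
exists (uniform_design R ([set hi k | k in 'I_d] :|: [set lo k | k in 'I_d])).
exists (fun k : 'I_d => (F (S k)).1), hi, lo,
  (fun k : 'I_d => (F (S k)).2.2).
split=> //.
- by move=> k; have [h1 h2 _ _ _] := hS k; split=> // l lk; exact/h2/mS.
- by move=> k i; have [_ _ h _ _] := hS k; exact: h.
- by move=> k; have [_ _ _ h1 h2] := hS k.
Qed.

End VolumetricInit.

Section AwayExistence.
Variables (R : realType) (n d : nat) (A : 'M[R]_(n, d)).

Lemma away_sequence_exists (i0 : 'I_n) : \rank A = d -> (1 < d)%N ->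
  exists p, away_sequence A p.
Proof.
move=> rA d1; have [p0 ip0] := volumetric_init_exists A i0.
have /choice[F hF] : forall p, exists q, spanning_design A p ->
    away_step_update d (leverage A) p q.
  move=> p; have [sp|] := pselect (spanning_design A p); last by exists p.
  by have [q hq] := away_step_update_exists sp; exists q.
exists (fun k => iter k F p0); split=> // k /=; apply: (hF).
elim: k => [|k IH] /=; first exact: volumetric_init_spanning (ltnW d1) _ ip0.
by have [] := away_step_update_cases d1 IH (hF _ IH).
Qed.

End AwayExistence.

(** * The optimal face *)

Section Face.
Variables (R : realType) (n d : nat) (A : 'M[R]_(n, d)) (S : {set 'I_n}).
Implicit Types (p x y : 'cV[R]_n) (z : 'cV[R]_#|S|).

Lemma face_extend_in z k : face_extend z (enum_val k) 0 = z k 0.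
Proof.
rewrite /face_extend summxE (bigD1 k) //= !mxE !eqxx mulr1 big1 ?addr0 // => l lk.
by rewrite !mxE (inj_eq enum_val_inj) eq_sym (negPf lk) mulr0.
Qed.

Lemma face_extend_out z i : i \notin S -> face_extend z i 0 = 0.
Proof.
move=> iS; rewrite /face_extend summxE big1 // => l _.
rewrite !mxE; case: eqVneq => [e|_]; last by rewrite mulr0.
by rewrite e enum_valP in iS.
Qed.

Lemma face_extend_supp z : supp (face_extend z) \subset S.
Proof.
apply/fintype.subsetP => i; rewrite inE; apply: contraR => iS.
by rewrite face_extend_out.
Qed.

Lemma face_restrictK z : face_restrict S (face_extend z) = z.
Proof. by apply/colP => k; rewrite mxE face_extend_in. Qed.

Lemma face_extendK x : supp x \subset S -> face_extend (face_restrict S x) = x.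
Proof.
move=> /fintype.subsetP sx; apply/colP => i; have [iS|iS] := boolP (i \in S).
  by rewrite -(enum_rankK_in iS iS) face_extend_in mxE.
rewrite face_extend_out //; apply/esym/eqP; apply: contraNT iS => xi; apply: sx.
by rewrite inE.
Qed.

Lemma sum_supp x (F : 'I_n -> R) : supp x \subset S ->
  \sum_i x i 0 * F i = \sum_(k < #|S|) face_restrict S x k 0 * F (enum_val k).
Proof.
move=> /fintype.subsetP sx.
rewrite (bigID (mem S)) /= [X in _ + X]big1 ?addr0 => [|i iS].
  by rewrite (big_enum_val (fun i => x i 0 * F i)); apply: eq_bigr => k _; rewrite mxE.
have [->|xi] := eqVneq (x i 0) 0; first by rewrite mul0r.
by case/negP: iS; apply: sx; rewrite inE.
Qed.

Lemma sum_face_restrict x : supp x \subset S ->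
  \sum_i x i 0 = \sum_k face_restrict S x k 0.
Proof.
move=> sx; have := sum_supp (fun=> 1) sx.
by under eq_bigr do rewrite mulr1; under [RHS]eq_bigr do rewrite mulr1.
Qed.

Lemma dot_face_restrict x y : supp x \subset S ->
  ((face_restrict S x)^T *m face_restrict S y) 0 0 = \sum_i x i 0 * y i 0.
Proof.
move=> sx; rewrite dot_sum (sum_supp (fun i => y i 0) sx).
by apply: eq_bigr => k _; rewrite [face_restrict S y k 0]mxE.
Qed.

Lemma hess_face_sum p x y : supp y \subset S ->
  hess A p x y =
  \sum_l face_restrict S y l 0 * hess A p x (delta_mx (enum_val l) 0).
Proof.
move=> sy; rewrite -[in LHS](face_extendK sy) [X in hess _ _ _ X]/face_extend.
by rewrite raddf_sum; apply: eq_bigr => l _; rewrite /= hessZr.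
Qed.

Lemma facial_hessian_form p x y : supp x \subset S -> supp y \subset S ->
  ((face_restrict S x)^T *m facial_hessian A S p *m face_restrict S y) 0 0 =
  hess A p x y.
Proof.
move=> sx sy; rewrite (hess_face_sum _ _ sy) [LHS]mxE; apply: eq_bigr => l _.
rewrite hessC (hess_face_sum _ _ sx) [RHS]mulrC; congr (_ * _); rewrite [LHS]mxE.
apply: eq_bigr => k _; rewrite hessC hess_delta [X in X * _]mxE.
by rewrite [facial_hessian _ _ _ _ _]mxE.
Qed.

Lemma facial_hessian_sym p : (facial_hessian A S p)^T = facial_hessian A S p.
Proof.
have sV : (invmx (moment A p))^T = invmx (moment A p) by rewrite trmx_inv moment_sym.
apply/matrixP => k l; rewrite [LHS]mxE [LHS]mxE [RHS]mxE.
by rewrite (bilinear_formC _ _ sV).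
Qed.

Lemma supp_add x y : supp x \subset S -> supp y \subset S -> supp (x + y) \subset S.
Proof.
move=> /fintype.subsetP sx /fintype.subsetP sy; apply/fintype.subsetP => i.
rewrite inE mxE; apply: contraR => iS.
have -> : x i 0 = 0 by apply/eqP; apply: contraNT iS => h; apply: sx; rewrite inE.
have -> : y i 0 = 0 by apply/eqP; apply: contraNT iS => h; apply: sy; rewrite inE.
by rewrite addr0.
Qed.

Lemma supp_scale c x : supp x \subset S -> supp (c *: x) \subset S.
Proof.
move=> /fintype.subsetP sx; apply/fintype.subsetP => i; rewrite inE mxE => h.
by apply: sx; rewrite inE; apply: contra h => /eqP ->; rewrite mulr0.
Qed.

Lemma supp_delta i : i \in S -> supp (delta_mx i 0 : 'cV[R]_n) \subset S.
Proof.
move=> iS; apply/fintype.subsetP => j; rewrite inE !mxE eqxx andbT.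
by case: (eqVneq j i) => [->//|_]; rewrite eqxx.
Qed.

Hypothesis S_free : free [seq rank1 A i | i in S].

Lemma free_moment_eq0 x : supp x \subset S -> moment A x = 0 -> x = 0.
Proof.
move=> sx m0.
have /freeP h : free (image_tuple (rank1 A) S) by [].
have {}h : forall k, face_restrict S x k 0 = 0.
  apply: (h (fun k => face_restrict S x k 0)).
  rewrite -[RHS]m0 -{2}(face_extendK sx) raddf_sum /=.
  by apply: eq_bigr => k _; rewrite linearZ /= moment_delta nth_image.
rewrite -(face_extendK sx) (_ : face_restrict S x = 0).
  by rewrite /face_extend big1 // => k _; rewrite mxE scale0r.
by apply/colP => k; rewrite h mxE.
Qed.

(** The rank-one matrices live in a space of dimension d^2. This is the source of the d^2 in the
    cost, as a Newton iteration queries |S| shifted designs. *)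
Lemma free_face_card : (#|S| <= d * d)%N.
Proof.
have := S_free; rewrite /free size_image => /eqP <-.
by apply: leq_trans (dimvS (subvf _)) _; rewrite dimvf.
Qed.

(** The form vanishes only on vectors of zero moment, which independence excludes; positivity holds
    on all of the face space, not only on its tangent space. *)
Lemma facial_hessian_posdef p : posdef (moment A p) -> posdef (facial_hessian A S p).
Proof.
move=> pM; split=> [|z z0]; first exact: facial_hessian_sym.
have sz := face_extend_supp z.
rewrite -(face_restrictK z) facial_hessian_form // lt_def hess_ge0 // andbT.
apply: contra z0 => /eqP /(hess_eq0 pM) /(free_moment_eq0 sz) h.
by rewrite -(face_restrictK z) h; apply/eqP/colP => k; rewrite !mxE.
Qed.

End Face.

(** * Extreme eigenvalues as attained Rayleigh bounds *)

Section EigenvalueRange.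
Variables (R : realType) (n : nat) (S : {set 'I_n}) (H : 'M[R]_#|S|).
Hypothesis H_sym : H^T = H.
Implicit Types (x y : 'cV[R]_n).

(** The Rayleigh minimizer is a compression eigenvector, and every compression eigenvalue is a value
    of the quotient, so the infimum is attained. *)
Lemma inf_compression_eigenvalue :
  (exists2 x : 'cV[R]_n, facial_tangent S x & x != 0) ->
  let mu := inf [set a | compression_eigenvalue H (facial_tangent S) a] in
  compression_eigenvalue H (facial_tangent S) mu /\
  forall x, facial_tangent S x ->
    mu * ((face_restrict S x)^T *m face_restrict S x) 0 0 <=
    ((face_restrict S x)^T *m H *m face_restrict S x) 0 0.
Proof.
move=> [x0 [sx0 x0s] x00] mu.
(* The kernel of the all-ones row is the facial tangent space in face coordinates. *)
pose B : 'M[R]_(1, #|S|) := const_mx 1.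
have BE (z : 'cV[R]_#|S|) : B *m z = 0 <-> \sum_k z k 0 = 0.
  have e : (B *m z) 0 0 = \sum_k z k 0.
    by rewrite mxE; apply: eq_bigr => k _; rewrite mxE mul1r.
  split=> h; first by rewrite -e h mxE.
  by apply/matrixP => i j; rewrite !ord1 e h mxE.
have BT x : supp x \subset S -> B *m face_restrict S x = 0 <-> facial_tangent S x.
  move=> sx; rewrite BE -sum_face_restrict //.
  by split=> [h|[_ h]].
have ex : exists2 z : 'cV[R]_#|S|, B *m z = 0 & z != 0.
  exists (face_restrict S x0); first by apply/(BT _ sx0).
  apply: contra x00 => /eqP h; rewrite -(face_extendK sx0) h.
  by rewrite /face_extend big1 // => k _; rewrite mxE scale0r.
have [a [z [Bz z0 ez mz]]] := rayleigh_min_ker H_sym ex.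
have ca : compression_eigenvalue H (facial_tangent S) a.
  exists (face_extend z); split.
  - by apply/(BT _ (face_extend_supp z)); rewrite face_restrictK.
  - apply: contra z0 => /eqP h; rewrite -(face_restrictK z) h.
    by apply/eqP/colP => k; rewrite !mxE.
  - move=> y Ty; rewrite face_restrictK; apply: ez.
    by apply/(BT y) => //; case: Ty.
have ba b : compression_eigenvalue H (facial_tangent S) b -> a <= b.
  move=> [x [[sx xs] xn0 ex']]; have Tx : facial_tangent S x by [].
  have := mz (face_restrict S x); rewrite (ex' x Tx).
  have : 0 < ((face_restrict S x)^T *m face_restrict S x) 0 0.
    apply: sqnorm_gt0; apply: contra xn0 => /eqP h; rewrite -(face_extendK sx) h.
    by rewrite /face_extend big1 // => k _; rewrite mxE scale0r.
  by move=> p; rewrite ler_pM2r // => ->//; apply/BT.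
have -> : mu = a.
  apply/eqP; rewrite eq_le; apply/andP; split.
    by apply: ge_inf => //; exists a => b; exact: ba.
  by apply: lb_le_inf; [exists a|move=> b; exact: ba].
split=> // x Tx; apply: mz; apply/BT => //; by case: Tx.
Qed.

(** The maximum of the quotient is minus the minimum for - H, taken with the zero constraint. *)
Lemma form_le_sup_eigenvalue (z : 'cV[R]_#|S|) : z != 0 ->
  (z^T *m H *m z) 0 0 <= sup [set a | eigenvalue H a] * (z^T *m z) 0 0.
Proof.
move=> z00.
have sNH : (- H)^T = - H by rewrite linearN /= H_sym.
have ex : exists2 w : 'cV[R]_#|S|, (0 : 'M[R]_(1, #|S|)) *m w = 0 & w != 0.
  by exists z => //; rewrite mul0mx.
have [a [w [_ w0 ew mw]]] := rayleigh_min_ker sNH ex.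
have bound (y : 'cV[R]_#|S|) : (y^T *m H *m y) 0 0 <= - a * (y^T *m y) 0 0.
  have := mw y (mul0mx _ _); rewrite mulmxN mulNmx [X in _ <= X]mxE; lra.
have Hw : H *m w = - a *: w.
  apply/eqP; rewrite -subr_eq0; apply/eqP; apply: sqnorm_eq0.
  set y := _ - _.
  rewrite {2}/y mulmxBr -scalemxAr mulmxA [LHS]mxE [X in _ + X]mxE [X in _ - X]mxE.
  have := ew y (mul0mx _ _); rewrite mulmxN mulNmx [X in X = _ -> _]mxE; lra.
have ea : eigenvalue H (- a).
  apply/eigenvalueP; exists w^T.
    by rewrite -[LHS]trmxK trmx_mul trmxK H_sym Hw linearZ.
  by apply: contra w0 => /eqP /(congr1 trmx); rewrite trmxK trmx0 => ->.
apply: le_trans (bound z) _; apply: ler_wpM2r; first exact: sqnorm_ge0.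
apply: ub_le_sup => //; exists (- a) => b /eigenvalueP [v vH v0].
have vp : 0 < (v *m v^T) 0 0.
  rewrite -{1}[v]trmxK; apply: sqnorm_gt0.
  by apply: contra v0 => /eqP /(congr1 trmx); rewrite trmxK trmx0 => ->.
by have := bound v^T; rewrite trmxK vH -scalemxAl [X in X <= _]mxE ler_pM2r.
Qed.

End EigenvalueRange.

(** * Instance constants and the facial sublevel set *)

Section Instance.
Variables (R : realType) (n d : nat) (A : 'M[R]_(n, d)) (ps : 'cV[R]_n).
Hypotheses (ps_nondeg : nondegenerate_optimal A ps)
  (tangent_neq0 :
    exists2 x : 'cV[R]_n, facial_tangent (contact_set A ps) x & x != 0).

Let S := contact_set A ps.

Let ps_opt : optimal_design A ps. Proof. by case: ps_nondeg. Qed.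
Let ps_posdef : posdef (moment A ps). Proof. by case: ps_opt. Qed.
Let ps_supp : supp ps = S. Proof. by case: ps_nondeg. Qed.
Let S_free : free [seq rank1 A i | i in S]. Proof. by case: ps_nondeg. Qed.

Lemma contact_leverage i : i \in S -> leverage A ps i 0 = d%:R.
Proof. by rewrite inE => /eqP. Qed.

Lemma contact_card_gt1 : (1 < #|S|)%N.
Proof.
have [x [/fintype.subsetP sx xs] x0] := tangent_neq0.
rewrite ltnNge; apply/negP => /card_le1_eqP h.
have [i xi] : exists i, x i 0 != 0.
  apply/existsP; apply: contraNT x0 => /existsPn h'; apply/eqP/colP => i.
  by have := h' i; rewrite negbK [RHS]mxE => /eqP.
have iS : i \in S by apply: sx; rewrite inE.
move: xs; rewrite (bigD1 i) //= big1 => [/eqP|j ji]; first by rewrite addr0 (negPf xi).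
apply/eqP; apply: contraNT ji => xj; rewrite (h i j) //.
by apply: sx; rewrite inE.
Qed.

Lemma dim_gt1 : (1 < d)%N.
Proof.
have := leq_trans contact_card_gt1 (free_face_card S_free).
by case: (d) => [|[|]].
Qed.

Let d0 : 0 < d%:R :> R. Proof. by rewrite ltr0n ltnW // dim_gt1. Qed.

Lemma mu_star_tangent x : facial_tangent S x ->
  mu_star A ps * (\sum_i x i 0 * x i 0) <= hess A ps x x.
Proof.
move=> Tx; have [sx _] := Tx.
have [_ h] := inf_compression_eigenvalue (facial_hessian_sym A S ps) tangent_neq0.
by rewrite -(dot_face_restrict x sx) -(facial_hessian_form _ _ sx sx); exact: h.
Qed.

Lemma mu_star_eigenvector : exists x, [/\ facial_tangent S x,
  0 < \sum_i x i 0 * x i 0 &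
  hess A ps x x = mu_star A ps * (\sum_i x i 0 * x i 0)].
Proof.
have [[x [Tx x0 ex]] _] :=
  inf_compression_eigenvalue (facial_hessian_sym A S ps) tangent_neq0.
have [sx _] := Tx.
exists x; split=> //; first by rewrite -dot_sum; exact: sqnorm_gt0.
by rewrite -(dot_face_restrict x sx) -(facial_hessian_form _ _ sx sx); exact: ex.
Qed.

Lemma mu_star_gt0 : 0 < mu_star A ps.
Proof.
have [x [[sx _] xp e]] := mu_star_eigenvector.
rewrite -(pmulr_lgt0 _ xp) -e lt_def hess_ge0 // andbT.
apply: contraL xp => /eqP /(hess_eq0 ps_posdef) /(free_moment_eq0 S_free sx) ->.
by rewrite big1 ?ltxx // => i _; rewrite mxE mul0r.
Qed.

Lemma L_star_ge (x : 'cV[R]_n) : supp x \subset S -> x != 0 ->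
  hess A ps x x <= L_star A ps * (\sum_i x i 0 * x i 0).
Proof.
move=> sx x0; rewrite -(dot_face_restrict x sx) -(facial_hessian_form _ _ sx sx).
apply: (form_le_sup_eigenvalue (facial_hessian_sym A S ps)).
apply: contra x0 => /eqP h; rewrite -(face_extendK sx) h.
by rewrite /face_extend big1 // => k _; rewrite mxE scale0r.
Qed.

Lemma mu_star_le_L_star : mu_star A ps <= L_star A ps.
Proof.
have [x [[sx _] xp e]] := mu_star_eigenvector.
rewrite -(ler_pM2r xp) -e; apply: L_star_ge => //.
by apply: contraL xp => /eqP ->; rewrite big1 ?ltxx // => i _; rewrite mxE mul0r.
Qed.

(** A diagonal entry of the facial Hessian at the optimum is a squared leverage score, d^2. *)
Lemma L_star_ge_sqr : d%:R ^+ 2 <= L_star A ps.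
Proof.
have /card_gt0P[i iS] : (0 < #|S|)%N by rewrite ltnW // contact_card_gt1.
have := @L_star_ge (delta_mx i 0) (supp_delta _ iS).
rewrite hess_delta (_ : \sum_j _ = 1) ?mulr1; last first.
  rewrite (bigD1 i) //= big1 ?addr0 => [|j ji]; first by rewrite !mxE !eqxx mulr1.
  by rewrite !mxE (negPf ji) mul0r.
have -> : ((arow A i)^T *m invmx (moment A ps) *m arow A i) 0 0 = d%:R.
  by rewrite -(contact_leverage iS) [RHS]mxE.
apply; apply/eqP => /colP /(_ i) /eqP; by rewrite !mxE !eqxx oner_eq0.
Qed.

Lemma theta_N_ge4 : 4 <= theta_N A ps.
Proof.
have mp := mu_star_gt0; have mL := mu_star_le_L_star; have dL := L_star_ge_sqr.
rewrite /theta_N -mulrA ler_peMr // ler_pdivlMr // mul1r.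
rewrite -(@ler_pXn2r _ 2) ?nnegrE ?sqrtr_ge0 ?ler0n //.
have k1 : 1 <= kappa A ps by rewrite /kappa ler_pdivlMr // mul1r.
have h : d%:R ^+ 2 <= 3 * L_star A ps * kappa A ps by nra.
by rewrite sqr_sqrtr // (le_trans _ h) // sqr_ge0.
Qed.

Let gamma := gamma_sc A ps.

Lemma gamma_sc_le i : i \notin S -> (gamma <= (d%:R - leverage A ps i 0)%:E)%E.
Proof. by move=> iS; exact: bigmin_le_cond. Qed.

Let rE := mine (2^-1)%:E (mine (gamma * ((2 * d%:R)^-1)%:E)
               (p_min A ps * (Num.sqrt (mu_star A ps) / 2)%:E))%E.

(** The entry 1/2 keeps the minimum finite even when [gamma_sc] is +oo, so [fine] loses nothing and
    the bounds on [r_bar] can be read off the extended minimum. *)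
Lemma r_bar_fine : (0 < rE)%E /\ rE = (r_bar A ps)%:E.
Proof.
have [_ _ g0 _] := ps_nondeg.
have [[p0 _] _ _] := ps_opt.
have r0 : (0 < rE)%E.
  rewrite !lt_min lte_fin invr_gt0 ltr0n /= mule_gt0 //=; last first.
    by rewrite lte_fin invr_gt0 mulr_gt0.
  rewrite mule_gt0 //; last by rewrite lte_fin divr_gt0 // sqrtr_gt0 mu_star_gt0.
  apply/bigmin_gtP; split=> // i iS.
  by rewrite lte_fin lt_def p0 andbT; move: iS; rewrite -/S -ps_supp inE.
split=> //; rewrite /r_bar fineK // ge0_fin_numE ?ltW //.
by apply: le_lt_trans (ltry 2^-1); rewrite ge_min lexx.
Qed.

Lemma r_bar_gt0 : 0 < r_bar A ps.
Proof. by have [h e] := r_bar_fine; rewrite e lte_fin in h. Qed.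

Lemma r_bar_le_half : r_bar A ps <= 2^-1.
Proof. by rewrite -lee_fin -(r_bar_fine).2 ge_min lexx. Qed.

Lemma r_bar_le_gap i : i \notin S ->
  r_bar A ps * (2 * d%:R) <= d%:R - leverage A ps i 0.
Proof.
move=> iS; rewrite -ler_pdivlMr ?mulr_gt0 // -lee_fin -(r_bar_fine).2.
rewrite !ge_min; apply/orP; right; apply/orP; left.
have h : (0 <= ((2 * d%:R)^-1)%:E :> \bar R)%E.
  by rewrite lee_fin invr_ge0 mulr_ge0 // ltW.
by rewrite EFinM; exact: (lee_wpmul2r h (gamma_sc_le iS)).
Qed.

Lemma r_bar_le_weight i : i \in S ->
  r_bar A ps <= ps i 0 * (Num.sqrt (mu_star A ps) / 2).
Proof.
move=> iS; rewrite -lee_fin -(r_bar_fine).2.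
rewrite !ge_min; apply/orP; right; apply/orP; right.
have h : (0 <= (Num.sqrt (mu_star A ps) / 2)%:E)%E.
  by rewrite lee_fin divr_ge0 // sqrtr_ge0.
have w : (p_min A ps <= (ps i 0)%:E)%E by exact: bigmin_le_cond.
by rewrite EFinM; exact: (lee_wpmul2r h w).
Qed.

Lemma weight_gt0 i : i \in S -> 0 < ps i 0.
Proof.
have [[p0 _] _ _] := ps_opt.
by move=> iS; rewrite lt_def p0 andbT; move: iS; rewrite -ps_supp inE.
Qed.

Lemma c_zero_gt0 : 0 < c_zero A ps.
Proof. by rewrite /c_zero zeta_gt0 // r_bar_gt0. Qed.

Lemma c_zero_le : c_zero A ps <= 3 / 8.
Proof.
have r0 := r_bar_gt0; have r2 := r_bar_le_half.
have r1 : `|r_bar A ps| < 1 by rewrite gtr0_norm //; lra.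
(* 3/8 is the value of 3/4 r^2 / (1 - r) at r = 1/2. *)
apply: le_trans (zeta_le_quadratic r1) _.
rewrite gtr0_norm // ler_pdivrMr; last by lra.
nra.
Qed.

Lemma half_r_bar01 : 0 < r_bar A ps < 1.
Proof. have r0 := r_bar_gt0; have r2 := r_bar_le_half; lra. Qed.

Lemma sublevel_weights q : facial_sublevel A ps q ->
  [/\ design q, supp q = S & forall i,
    (1 - r_bar A ps) * leverage A q i 0 <= leverage A ps i 0
      <= (1 + r_bar A ps) * leverage A q i 0].
Proof.
move=> [sq q1 qM fq]; have [[p0 p1] _ _] := ps_opt.
have gq : grad A ps (q - ps) <= 0.
  rewrite gradB grad_id // grad_sum (_ : \sum_i _ = d%:R) ?subrr //.
  rewrite (eq_bigr (fun i => q i 0 * d%:R)); first by rewrite -mulr_suml q1 mul1r.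
  move=> i _; have [->|qi] := eqVneq (q i 0) 0; first by rewrite !mul0r.
  by rewrite contact_leverage //; apply: (fintype.subsetP sq); rewrite inE.
have r0 := r_bar_gt0.
have hb := sublevel_ball ps_opt qM r0 gq fq.
have Tq : facial_tangent S (q - ps).
  split; last first.
    by under eq_bigr do rewrite mxE [X in _ + X]mxE; rewrite sumrB q1 p1 subrr.
  by rewrite -scaleN1r; apply: supp_add => //; apply: supp_scale; rewrite ps_supp.
have hm := mu_star_tangent Tq; have mp := mu_star_gt0.
have qS i : i \in S -> 0 < q i 0.
  move=> iS; have w := weight_gt0 iS; have rw := r_bar_le_weight iS.
  have sm : 0 < Num.sqrt (mu_star A ps) by rewrite sqrtr_gt0.
  have smE : Num.sqrt (mu_star A ps) ^+ 2 = mu_star A ps by rewrite sqr_sqrtr // ltW.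
  (* Strong convexity along the face bounds the left side by r_bar^2; the weight term of [r_bar]
     then makes |q_i - ps_i| at most half of ps_i. *)
  have : mu_star A ps * (q i 0 - ps i 0) ^+ 2 <= (ps i 0 * (Num.sqrt (mu_star A ps) / 2)) ^+ 2.
    apply: le_trans (_ : r_bar A ps ^+ 2 <= _); last first.
      by rewrite ler_pXn2r ?nnegrE // ?mulr_ge0 // ltW.
    apply: le_trans hb; apply: le_trans hm; rewrite ler_pM2l //.
    rewrite (bigD1 i) //= !mxE -expr2 lerDl sumr_ge0 // => j _.
    by rewrite -expr2 sqr_ge0.
  rewrite exprMn exprMn smE mulrCA ler_pM2l // -exprMn.
  rewrite -[leLHS]real_normK ?num_real // ler_pXn2r ?nnegrE //
    ?divr_ge0 ?mulr_ge0 ?invr_ge0 ?(ltW w) //.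
  rewrite ler_norml; lra.
split.
- split=> // i; have [/qS/ltW //|iS] := boolP (i \in S).
  have [->//|qi] := eqVneq (q i 0) 0.
  by case/negP: iS; apply: (fintype.subsetP sq); rewrite inE.
- apply/setP => i; apply/idP/idP; first exact: (fintype.subsetP sq).
  by move=> /qS qi; rewrite inE gt_eqF.
- exact: (sublevel_leverage ps_opt qM half_r_bar01 gq fq).
Qed.

(** The gap term of [r_bar] puts the optimal score below d - 2dr, hence below (1 - r) d. *)
Lemma sublevel_leverage_out q i : facial_sublevel A ps q -> i \notin S ->
  leverage A q i 0 < d%:R.
Proof.
move=> /sublevel_weights[_ _ /(_ i)/andP[h _]] iS.
have r2 := r_bar_le_half; have r0 := r_bar_gt0; have g := r_bar_le_gap iS.
have := d0; nra.
Qed.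

Lemma sublevel_leverage_in q i : facial_sublevel A ps q -> i \in S ->
  leverage A q i 0 <= 2 * d%:R.
Proof.
move=> sq iS; have [_ _ /(_ i)/andP[h _]] := sublevel_weights sq.
have [_ _ qM _] := sq; have v0 := leverage_ge0 i qM.
have r2 := r_bar_le_half; rewrite contact_leverage // in h; nra.
Qed.

End Instance.

(** * Newton's method on the face *)

Section NewtonStep.
Variables (R : realType) (n d : nat) (A : 'M[R]_(n, d)) (S : {set 'I_n}).
Implicit Types (p q x y : 'cV[R]_n).

Lemma hessDr p x y1 y2 : hess A p x (y1 + y2) = hess A p x y1 + hess A p x y2.
Proof. exact: (raddfD (hess A p x)). Qed.

Lemma hess_Cauchy_Schwarz p x y : posdef (moment A p) ->
  hess A p x y ^+ 2 <= hess A p x x * hess A p y y.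
Proof.
move=> pM; set X := hess A p x y; set B := hess A p y y; set Y := hess A p x x.
have : 0 <= B * (B * Y - X ^+ 2).
  have -> : B * (B * Y - X ^+ 2) = hess A p (B *: x + (- X) *: y) (B *: x + (- X) *: y).
    rewrite hessDr !hessZr ![hess A p (_ + _) _]hessC !hessDr !hessZr.
    by rewrite [hess A p y x]hessC -/X -/B -/Y; ring.
  exact: hess_ge0.
have [B0|B0] := eqVneq B 0; last first.
  have Bp : 0 < B by rewrite lt_def B0 hess_ge0.
  by rewrite pmulr_rge0 // subr_ge0 mulrC.
by rewrite /X /hess (hess_eq0 pM B0) mulmx0 mxtrace0 expr0n /= B0 mulr0.
Qed.

Lemma hess_self p y : posdef (moment A p) -> hess A p p y = grad A p y.
Proof. by move=> /posdef_unit[uM _]; rewrite /hess /grad mulVmx // mul1mx. Qed.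

(** Eliminating the vector leaves one scalar equation for the multiplier, with coefficient 1^T H^-1
    1 > 0. *)
Lemma constrained_system_unique k (H : 'M[R]_k) (v : 'cV[R]_k) :
  posdef H -> (0 < k)%N ->
  exists z : 'cV[R]_k * R, unique (fun z =>
    H *m z.1 + z.2 *: const_mx 1 = v /\ \sum_i z.1 i 0 = 0) z.
Proof.
move=> pH k0; have [uH _] := posdef_unit pH; have [sH qH] := pH.
pose one : 'cV[R]_k := const_mx 1.
have oneE (z : 'cV[R]_k) : (one^T *m z) 0 0 = \sum_i z i 0.
  by rewrite dot_sum; apply: eq_bigr => i _; rewrite mxE mul1r.
have one0 : one != 0.
  by apply/eqP => /colP /(_ (Ordinal k0)) /eqP; rewrite !mxE oner_eq0.
pose u := invmx H *m one; pose w := invmx H *m v.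
have uE : H *m u = one by rewrite mulKVmx.
have wE : H *m w = v by rewrite mulKVmx.
clearbody u w.
have u0 : 0 < \sum_i u i 0.
  have un0 : u != 0 by apply: contra one0 => /eqP h; rewrite -uE h mulmx0.
  by have := qH u un0; rewrite -mulmxA uE dotC oneE.
pose nu := (\sum_i w i 0) / (\sum_i u i 0).
exists (w - nu *: u, nu); split=> /=.
  split; first by rewrite mulmxBr -scalemxAr wE uE subrK.
  under eq_bigr do rewrite mxE [X in _ + X]mxE [X in _ - X]mxE.
  by rewrite sumrB -mulr_sumr /nu divfK ?subrr // gt_eqF.
move=> [z eta] /= [Hz z1].
set e := w - nu *: u.
have de : H *m (e - z) + (nu - eta) *: one = 0.
  rewrite mulmxBr scalerBl addrACA -opprD Hz /e mulmxBr -scalemxAr wE uE.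
  by rewrite subrK subrr.
have e1 : \sum_i e i 0 = 0.
  rewrite /e; under eq_bigr do rewrite mxE [X in _ + X]mxE [X in _ - X]mxE.
  by rewrite sumrB -mulr_sumr /nu divfK ?subrr // gt_eqF.
have ez : e - z = 0.
  apply/eqP; apply: contraT => /qH; rewrite -mulmxA.
  have -> : H *m (e - z) = - ((nu - eta) *: one).
    by apply/eqP; rewrite -addr_eq0 de.
  rewrite mulmxN -scalemxAr mxE [X in - X]mxE dotC oneE.
  under eq_bigr do rewrite mxE [X in _ + X]mxE.
  by rewrite sumrB e1 z1 subrr mulr0 oppr0 ltxx.
congr (_, _); first by apply/eqP; rewrite -subr_eq0 ez.
move: de; rewrite ez mulmx0 add0r => /eqP; rewrite scaler_eq0 (negPf one0) orbF.
by rewrite subr_eq0 => /eqP.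
Qed.

(** Halving p + e_j makes it a design and doubles the scores, which the factor 1/2 undoes; the
    rank-one update formula then gives the squared entry. *)
Lemma queried_hessianE p : posdef (moment A p) ->
  queried_hessian (leverage A) S p = facial_hessian A S p.
Proof.
move=> pM; apply/matrixP => i j; rewrite [LHS]mxE [RHS]mxE.
have v0 := leverage_ge0 (enum_val j) pM.
have pj : posdef (moment A (p + delta_mx (enum_val j) 0)).
  rewrite -[p]scale1r -[delta_mx _ _ in X in moment A X]scale1r.
  by apply: posdef_shift => //; rewrite mul1r; lra.
rewrite leverageZ ?invr_eq0 ?pnatr_eq0 // invrK mulrA mulVf ?pnatr_eq0 // mul1r.
rewrite leverage_rank1_update //= opprB addrCA subrr addr0 mulfVK //.
by rewrite gt_eqF //; lra.
Qed.

(** The Newton system without coordinates or multiplier: tested against tangent vectors, the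
    multiple of the all-ones vector disappears. *)
Definition newton_direction p x (lam : R) : Prop :=
  [/\ facial_tangent S x, 0 <= lam, lam ^+ 2 = hess A p x x &
      forall y, facial_tangent S y -> grad A p y = hess A p x y].

Lemma newton_step_exists p : free [seq rank1 A i | i in S] -> (0 < #|S|)%N ->
  posdef (moment A p) ->
  exists x lam, newton_direction p x lam /\
    newton_update (leverage A) S p
      (if 4^-1 < lam then p + (1 + lam)^-1 *: x else p + x).
Proof.
move=> Sfree S0 pM.
have [z [[Hz z1] uz]] := constrained_system_unique (face_restrict S (leverage A p))
  (facial_hessian_posdef Sfree pM) S0.
have sz := face_extend_supp z.1.
have Tz : facial_tangent S (face_extend z.1).
  by split=> //; rewrite (sum_face_restrict sz) face_restrictK.
have gE y : facial_tangent S y -> grad A p y = hess A p (face_extend z.1) y.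
  move=> [sy y1]; rewrite hessC -(facial_hessian_form _ _ sy sz) face_restrictK.
  have -> : grad A p y =
      ((face_restrict S y)^T *m face_restrict S (leverage A p)) 0 0.
    by rewrite dot_face_restrict // grad_sum.
  rewrite -Hz mulmxDr mulmxA mxE -scalemxAr [X in _ + X]mxE dot_sum.
  under [X in _ + _ * X]eq_bigr do rewrite [X in _ * X]mxE mulr1.
  by rewrite -sum_face_restrict // y1 mulr0 addr0.
have lE : \sum_k face_restrict S (leverage A p) k 0 * z.1 k 0 =
    hess A p (face_extend z.1) (face_extend z.1).
  rewrite -gE // grad_sum (sum_supp _ sz) face_restrictK.
  by apply: eq_bigr => k _; rewrite mxE mulrC.
exists (face_extend z.1), (Num.sqrt (\sum_k face_restrict S (leverage A p) k 0 * z.1 k 0)).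
split.
  by split=> //; rewrite ?sqrtr_ge0 // sqr_sqrtr lE // hess_ge0.
exists z; split=> //; split.
  by rewrite /newton_system queried_hessianE.
by move=> z'; rewrite /newton_system queried_hessianE //; exact: uz.
Qed.

(** Cauchy-Schwarz against y = e_i - p, along which the gradient is v - d; the squared norm v^2 - 2v
    + d of y is at most 9 d^2 since 0 <= v <= 2d. *)
Lemma newton_gap_in p x lam i : posdef (moment A p) -> supp p \subset S ->
  \sum_i p i 0 = 1 -> newton_direction p x lam -> (1 < d)%N ->
  i \in S -> leverage A p i 0 <= 2 * d%:R ->
  leverage A p i 0 <= d%:R + 3 * d%:R * lam.
Proof.
move=> pM sp p1 [Tx l0 lE gE] d1 iS v2; set v := leverage A p i 0 in v2 *.
have dr : 2 <= d%:R :> R by rewrite ler_nat.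
have v0 : 0 <= v by exact: leverage_ge0.
set y := delta_mx i 0 + (-1) *: p.
have Ty : facial_tangent S y.
  split; first by apply: supp_add; [exact: supp_delta|exact: supp_scale].
  rewrite /y; under eq_bigr do rewrite mxE [X in _ + X]mxE.
  by rewrite big_split /= sum_delta -mulr_sumr p1 mulr1 subrr.
have gy : grad A p y = v - d%:R.
  by rewrite /y gradD gradZ grad_id // grad_delta -/v; ring.
have hy : hess A p y y = v ^+ 2 - 2 * v + d%:R.
  rewrite /y hessDr hessZr ![hess A p (_ + _) _]hessC !hessDr !hessZr.
  rewrite [hess A p (delta_mx i 0) p]hessC !hess_self // grad_id // grad_delta -/v.
  rewrite hess_delta (_ : (_ 0 0) = v); last by rewrite /v [RHS]mxE.
  by ring.
have := hess_Cauchy_Schwarz x y pM; rewrite -gE // gy hy -lE => h.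
have h2 : (v - d%:R) ^+ 2 <= (3 * d%:R * lam) ^+ 2.
  apply: le_trans h _; rewrite [leRHS]exprMn mulrC; apply: ler_wpM2r; first exact: sqr_ge0.
  nra.
rewrite -lerBlDl; have [vd|vd] := leP 0 (v - d%:R).
  by rewrite -(@ler_pXn2r _ 2) ?nnegrE // !mulr_ge0 ?ler0n.
by apply: le_trans (ltW vd) _; rewrite !mulr_ge0 ?ler0n.
Qed.

(** The step has local length 1 - t, so the quadratic bound costs 3/4 of the linear gain t lam^2.
    What remains is at least 1/80, because lam^2 / (1 + lam) exceeds 1/20 for lam > 1/4. *)
Lemma newton_damped_descent p x lam : posdef (moment A p) ->
  newton_direction p x lam -> 4^-1 < lam ->
  posdef (moment A (p + (1 + lam)^-1 *: x)) /\
  objective A (p + (1 + lam)^-1 *: x) <= objective A p - 80^-1.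
Proof.
move=> pM [Tx l0 lE gE] l4; set t := (1 + lam)^-1.
have l1 : 0 < 1 + lam by lra.
have t0 : 0 < t by rewrite invr_gt0.
have tl : t * lam = 1 - t by rewrite /t; field; rewrite gt_eqF.
have hs : hess A p (t *: x) (t *: x) = (t * lam) ^+ 2 by rewrite hessZ -lE exprMn.
have s01 : 0 <= t * lam < 1.
  have := mulr_ge0 (ltW t0) l0; rewrite tl; lra.
have hs' : hess A p (t *: x) (t *: x) <= (t * lam) ^+ 2 by rewrite hs.
have [h1 _] := leverage_ball pM s01 hs'.
split=> //; apply: le_trans (objective_descent pM s01 hs) _.
rewrite gradZ gE // -lE.
have -> : 3 / 4 * (t * lam) ^+ 2 / (1 - t * lam) = 3 / 4 * (t * lam ^+ 2).
  by rewrite tl opprB addrCA subrr addr0 -tl; field; rewrite gt_eqF.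
have : 20^-1 <= t * lam ^+ 2.
  by rewrite mulrC ler_pdivlMr //; nra.
lra.
Qed.

(** For the decrement, the residual bound is tested on the next Newton direction itself and one
    factor lam'^2 cancels. *)
Lemma newton_full_descent p x lam : posdef (moment A p) ->
  newton_direction p x lam -> lam <= 4^-1 ->
  [/\ posdef (moment A (p + x)), objective A (p + x) <= objective A p &
      forall x' lam', newton_direction (p + x) x' lam' -> lam' <= lam ^+ 2].
Proof.
move=> pM [Tx l0 lE gE] l4.
have s01 : 0 <= lam < 1 by rewrite l0 /=; lra.
have lE2 : hess A p x x <= lam ^+ 2 by rewrite lE.
have [h1 _] := leverage_ball pM s01 lE2.
split=> //.
  apply: le_trans (objective_descent pM s01 (esym lE)) _.
  rewrite gE // -lE.
  have : 3 / 4 * lam ^+ 2 / (1 - lam) <= lam ^+ 2.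
    by rewrite ler_pdivrMr; nra.
  lra.
move=> x' lam' [Tx' l0' lE' gE'].
have hx : hess A p x x < 1 by rewrite -lE; nra.
have := newton_residual pM hx (gE _ Tx'); rewrite gE' // -lE' -lE.
have [->|ln0] := eqVneq lam' 0; first by rewrite sqr_ge0.
have lp : 0 < lam' ^+ 2 by rewrite exprn_even_gt0.
rewrite [X in X <= _]expr2 ler_pM2r // ler_pXn2r ?nnegrE //.
exact: sqr_ge0.
Qed.

End NewtonStep.

(** * Iteration counts and query accounting *)

Section Complexity.
Variables (R : realType) (n d : nat) (A : 'M[R]_(n, d)) (ps : 'cV[R]_n).
Hypotheses (ps_nondeg : nondegenerate_optimal A ps)
  (tangent_neq0 :
    exists2 x : 'cV[R]_n, facial_tangent (contact_set A ps) x & x != 0).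

Let S := contact_set A ps.
Let d1 : (1 < d)%N. Proof. exact: dim_gt1 ps_nondeg tangent_neq0. Qed.
Let S_free : free [seq rank1 A i | i in S]. Proof. by case: ps_nondeg. Qed.
Let S_gt0 : (0 < #|S|)%N.
Proof. exact: ltnW (contact_card_gt1 tangent_neq0). Qed.
Let ps_opt : optimal_design A ps. Proof. by case: ps_nondeg. Qed.

Lemma vmax_subP (v : 'cV[R]_n) (b c : R) :
  reflect (forall i, v i 0 <= b + c) (vmax v - b%:E <= c%:E)%E.
Proof.
rewrite leeBlDl // -EFinD; apply: (iffP (bigmax_leP _ _ _ _)) => [[_ h] i|h].
  by rewrite -lee_fin h.
by split=> [|i _]; [exact: leNye|rewrite lee_fin].
Qed.

Lemma sublevel_move p x c : facial_sublevel A ps p -> facial_tangent S x ->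
  posdef (moment A (p + c *: x)) ->
  objective A (p + c *: x) <= objective A p ->
  facial_sublevel A ps (p + c *: x).
Proof.
move=> [sp p1 pM fp] [sx x1] qM fq; split=> //.
- by apply: supp_add => //; exact: supp_scale.
- under eq_bigr do rewrite mxE [X in _ + X]mxE.
  by rewrite big_split /= -mulr_sumr x1 mulr0 addr0.
- exact: le_trans fq fp.
Qed.

Definition accurate_run (eps : R) p t r : Prop :=
  [/\ facial_newton d (leverage A) S eps p t r, legal_queries A t
    & john_ellipsoid A eps r].

Lemma accurate_run_return eps p : facial_sublevel A ps p ->
  (vmax (leverage A p) - d%:R%:E <= (eps * d%:R)%:E)%E ->
  accurate_run eps p [:: p] p.
Proof.
move=> pC h; have [_ _ pM _] := pC.
have [dp _ _] := sublevel_weights ps_nondeg tangent_neq0 pC.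
split; first exact: facial_newton_return.
  by move=> w; rewrite inE => /eqP ->.
by split=> //; rewrite mulrDl mul1r EFinD -leeBlDl.
Qed.

Lemma accurate_run_step eps p q t r : facial_sublevel A ps p ->
  ~~ (vmax (leverage A p) - d%:R%:E <= (eps * d%:R)%:E)%E ->
  newton_update (leverage A) S p q -> accurate_run eps q t r ->
  accurate_run eps p
    (p :: [seq 2^-1 *: (p + delta_mx j 0) | j <- enum S] ++ t) r.
Proof.
move=> [_ _ pM _] h u [ft lt jr]; split=> //; first exact: facial_newton_step u ft.
move=> w; rewrite inE mem_cat => /predU1P[->//|/orP[/mapP[j _ ->]|]]; last exact: lt.
rewrite scalerDr; apply: posdef_shift; rewrite ?invr_gt0 ?ltr0n //.
have := leverage_ge0 j pM => v0.
by rewrite ltr_pwDl ?invr_gt0 ?ltr0n // mulr_ge0 // invr_ge0 ler0n.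
Qed.

Lemma newton_gap p x lam i : facial_sublevel A ps p ->
  newton_direction A S p x lam ->
  leverage A p i 0 <= d%:R + 3 * d%:R * lam.
Proof.
move=> pC xd; have [sp p1 pM _] := pC; have [_ l0 _ _] := xd.
have [iS|iS] := boolP (i \in S).
  apply: (newton_gap_in pM sp p1 xd d1 iS).
  exact: (sublevel_leverage_in ps_nondeg tangent_neq0 pC iS).
apply: le_trans (ltW (sublevel_leverage_out ps_nondeg tangent_neq0 pC iS)) _.
by rewrite lerDl !mulr_ge0 ?ler0n.
Qed.

(** k budgets the full steps still allowed: squaring lam lowers k by one, and at k = 0 the gap bound
    3 d lam is already below eps d. The final + 1 is the query of the returning test. *)
Lemma quadratic_phase eps k : 0 < eps -> forall p x lam,
  facial_sublevel A ps p -> newton_direction A S p x lam ->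
  newton_update (leverage A) S p (p + x) -> lam <= 4^-1 ->
  3 * lam ^+ (2 ^ k) <= eps ->
  exists t r, accurate_run eps p t r /\ (size t <= k * #|S|.+1 + 1)%N.
Proof.
move=> e0; elim: k => [|k IH] p x lam pC xd u l4 le.
  exists [:: p], p; split=> //; apply: accurate_run_return => //.
  apply/vmax_subP => i; apply: le_trans (newton_gap i pC xd) _.
  by rewrite lerD2l mulrAC ler_wpM2r.
have [h|h] := boolP (vmax (leverage A p) - d%:R%:E <= (eps * d%:R)%:E)%E.
  by exists [:: p], p; split; [exact: accurate_run_return|rewrite addn1].
have [sp p1 pM fp] := pC; have [Tx l0 lE gE] := xd.
have [qM fq hq] := newton_full_descent pM xd l4.
have qC : facial_sublevel A ps (p + x).
  by rewrite -[x]scale1r; apply: sublevel_move => //; rewrite scale1r.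
have [x' [l' [xd' u']]] := newton_step_exists S_free S_gt0 qM.
have [Tx' l0' _ _] := xd'.
have ll' := hq _ _ xd'.
have l4' : l' <= 4^-1 by nra.
rewrite ltNge l4' /= in u'.
have le' : 3 * l' ^+ (2 ^ k) <= eps.
  apply: le_trans le; rewrite ler_pM2l // expnS exprM.
  by apply: lerXn2r; rewrite ?nnegrE // sqr_ge0.
have [t [r [rt st]]] := IH _ _ _ qC xd' u' l4' le'.
exists (p :: [seq 2^-1 *: (p + delta_mx j 0) | j <- enum S] ++ t), r; split.
  exact: accurate_run_step u rt.
by rewrite /= size_cat size_map -cardE mulSn -addnA addSn ltnS leq_add2l.
Qed.

Lemma damped_phase eps k j : 0 < eps -> 3 * 4^-1 ^+ (2 ^ k) <= eps -> forall p,
  facial_sublevel A ps p -> objective A p <= objective A ps + j%:R / 80 ->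
  exists t r, accurate_run eps p t r /\ (size t <= (j + k) * #|S|.+1 + 1)%N.
Proof.
move=> e0 hk; elim: j => [|j IH] p pC fp; have [sp p1 pM _] := pC;
  have [x [lam [xd u]]] := newton_step_exists S_free S_gt0 pM;
  have [Tx l0 lE gE] := xd; case: (ltP 4^-1 lam) u => l4 u.
(* With no excess left, a damped step would lead to a design below the optimum. *)
- exfalso; have [qM fq] := newton_damped_descent pM xd l4.
  have qC : facial_sublevel A ps (p + (1 + lam)^-1 *: x).
    by apply: sublevel_move => //; apply: le_trans fq _; lra.
  have [dq _ _] := sublevel_weights ps_nondeg tangent_neq0 qC.
  have [_ _ /(_ _ dq qM)] := ps_opt.
  have : 0 < 80^-1 :> R by rewrite invr_gt0.
  by rewrite mul0r in fp; lra.
- apply: (quadratic_phase e0 pC xd u l4) => //; apply: le_trans hk.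
  by rewrite ler_pM2l //; apply: lerXn2r; rewrite ?nnegrE //; lra.
- have [h|h] := boolP (vmax (leverage A p) - d%:R%:E <= (eps * d%:R)%:E)%E.
    by exists [:: p], p; split; [exact: accurate_run_return|rewrite addn1].
  have [qM fq] := newton_damped_descent pM xd l4.
  have qC : facial_sublevel A ps (p + (1 + lam)^-1 *: x).
    by apply: sublevel_move => //; apply: le_trans fq _; lra.
  have [|t [r [rt st]]] := IH _ qC.
    by apply: le_trans fq _; move: fp; rewrite -natr1 mulrDl; lra.
  exists (p :: [seq 2^-1 *: (p + delta_mx j 0) | j <- enum S] ++ t), r; split.
    exact: accurate_run_step u rt.
  by rewrite /= size_cat size_map -cardE addSn mulSn -addnA addSn ltnS leq_add2l.
- have [|t [r [rt st]]] := @quadratic_phase eps k e0 _ _ _ pC xd u l4.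
    apply: le_trans hk.
    by rewrite ler_pM2l //; apply: lerXn2r; rewrite ?nnegrE //; lra.
  by exists t, r; split=> //; apply: leq_trans st _; rewrite leq_add2r leq_mul2r leq_addl orbT.
Qed.

End Complexity.

Section IterationCount.
Variable R : realType.

(** Minimality of the exponent k + 1 gives 4^(2^k) < X; two logarithms and ln 2 >= 1/2 yield k <= 2
    loglog X, and the 1 is absorbed because loglog X >= 1. *)
Lemma quadratic_iterations (X : R) : 4 < X ->
  exists k : nat, X <= 4 ^+ (2 ^ k) /\ k%:R <= 3 * loglog X.
Proof.
move=> X4.
have ex : exists k, X <= 4 ^+ (2 ^ k).
  exists (Num.truncn X); apply: le_trans (ltW (truncnS_gt X)) _.
  apply: le_trans (_ : (2 ^ (2 ^ Num.truncn X))%:R <= _); last first.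
    by rewrite natrX; apply: lerXn2r; rewrite ?nnegrE // ler_nat.
  rewrite ler_nat; apply: leq_trans (_ : 2 ^ Num.truncn X <= _)%N.
    exact: ltn_expl.
  by apply/ltnW/ltn_expl.
have [k Xk kmin] := ex_minnP ex.
exists k; split=> //; have ll1 : 1 <= loglog X by rewrite le_max lexx.
case: k Xk kmin => [|k] Xk kmin; first by rewrite mulr_ge0 // (le_trans _ ll1).
have hk : 4 ^+ (2 ^ k) < X.
  by rewrite ltNge; apply/negP => /kmin; rewrite ltnn.
have l2 : 2^-1 <= ln (2 : R).
  by have := @ln_ge1subV R 2 (ltr0n _ 2); lra.
have l4 : 1 <= ln (4 : R).
  have -> : (4 : R) = 2 ^+ 2 by ring.
  by rewrite lnXn // mulr2n; lra.
have lX : 2 ^+ k <= ln X.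
  have : ln (4 ^+ (2 ^ k)) <= ln X.
    by rewrite ler_ln ?posrE ?exprn_gt0 // ?(ltW hk) //; lra.
  apply: le_trans; rewrite lnXn // -[_ *+ (2 ^ k)]mulr_natl natrX.
  by rewrite ler_peMr // exprn_ge0.
have llX : k%:R * ln 2 <= ln (ln X).
  have : ln (2 ^+ k : R) <= ln (ln X).
    by rewrite ler_ln ?posrE ?exprn_gt0 // (lt_le_trans _ lX) ?exprn_gt0.
  by rewrite lnXn // -[_ *+ k]mulr_natl.
have ll : ln (ln X) <= loglog X by rewrite le_max lexx orbT.
have k0 : 0 <= k%:R :> R by [].
rewrite -natr1; nra.
Qed.

End IterationCount.

(** * The two-stage algorithm *)

Section TwoStage.
Variables (R : realType) (n d : nat) (A : 'M[R]_(n, d)) (ps : 'cV[R]_n).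
Hypotheses (ps_nondeg : nondegenerate_optimal A ps)
  (tangent_neq0 :
    exists2 x : 'cV[R]_n, facial_tangent (contact_set A ps) x & x != 0).

Let S := contact_set A ps.
Let r := r_bar A ps.
Let c0 := c_zero A ps.
Let d1 : (1 < d)%N. Proof. exact: dim_gt1 ps_nondeg tangent_neq0. Qed.
Let d0 : 0 < d%:R :> R. Proof. by rewrite ltr0n ltnW. Qed.
Let ps_opt : optimal_design A ps. Proof. by case: ps_nondeg. Qed.
Let r_gt0 : 0 < r. Proof. exact: r_bar_gt0 ps_nondeg tangent_neq0. Qed.
Let r_half : r <= 2^-1. Proof. exact: r_bar_le_half ps_nondeg tangent_neq0. Qed.

(** The added 1 pays for the query of the test that ends the loop. The constant comes from (31 + k)
    * 2 d^2 with k <= 3 loglog X. *)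
Lemma accuracy_phase (q : 'cV[R]_n) (eps : R) : facial_sublevel A ps q ->
  0 < eps < 1 -> exists t w, accurate_run A ps eps q t w /\
    (size t)%:R + 1 <= 70 * d%:R ^+ 2 * loglog (theta_N A ps / eps).
Proof.
move=> qC /andP[e0 e1].
have th := theta_N_ge4 ps_nondeg tangent_neq0.
set X := theta_N A ps / eps.
have X4 : 4 < X by rewrite ltr_pdivlMr //; nra.
have [k [Xk kl]] := quadratic_iterations X4.
have hk : 3 * 4^-1 ^+ (2 ^ k) <= eps.
  have p4 : 0 < (4 : R) ^+ (2 ^ k) by rewrite exprn_gt0.
  rewrite exprVn ler_pdivrMr //.
  have : eps * X <= eps * 4 ^+ (2 ^ k) by rewrite ler_pM2l.
  by rewrite /X mulrCA divff ?gt_eqF // mulr1; lra.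
(* 30 damped steps: the excess is at most 3/8 = 30/80. *)
have fq : objective A q <= objective A ps + 30%:R / 80.
  have [_ _ _ h] := qC; apply: le_trans h _; rewrite lerD2l.
  by apply: le_trans (c_zero_le ps_nondeg tangent_neq0) _; lra.
have [t [w [run st]]] := damped_phase ps_nondeg tangent_neq0 e0 hk qC fq.
exists t, w; split=> //.
have mS : (#|S| <= d * d)%N by case: ps_nondeg => _ _ _; exact: free_face_card.
have dd : (1 <= d * d)%N by rewrite muln_gt0 ltnW.
have : (size t + 1 <= (31 + k) * (2 * (d * d)))%N.
  have h : (#|S|.+1 <= 2 * (d * d))%N by rewrite mul2n -addnn -addn1 leq_add.
  have h2 : ((30 + k) * #|S|.+1 <= (30 + k) * (2 * (d * d)))%N by rewrite leq_mul2l h orbT.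
  rewrite -[31%N]/(30.+1) addSn mulSn; move: st h2; rewrite -/S.
  move: ((30 + k) * #|S|.+1)%N ((30 + k) * (2 * (d * d)))%N => u v; lia.
rewrite -(ler_nat R) natrD => /le_trans; apply.
rewrite natrM natrD natrM natrM -expr2.
have ll1 : 1 <= loglog X by rewrite le_max lexx.
rewrite mulrA [leLHS]mulrAC.
have -> : 70 * d%:R ^+ 2 * loglog X = (35 * loglog X) * 2 * d%:R ^+ 2 by ring.
rewrite mulrAC ler_wpM2r ?sqr_ge0 //; lra.
Qed.

Lemma loop_stopsP (p : 'cV[R]_n) :
  reflect ((forall i, leverage A p i 0 <= d%:R + c0) /\
    (forall i, 0 < p i 0 -> (d%:R%:E - gamma_sc A ps * (2^-1)%:E <=
                             (leverage A p i 0)%:E)%E))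
   (~~ loop_continues d (leverage A) c0 (gamma_sc A ps) p).
Proof.
rewrite /loop_continues negb_or -!leNgt.
apply: (iffP andP) => [[/vmax_subP h1 /bigmin_geP[_ h2]]|[h1 h2]]; split=> //.
  exact/vmax_subP.
by apply/bigmin_geP; split=> //; exact: leey.
Qed.

Lemma r_bar_le_gamma : ((r * (2 * d%:R))%:E <= gamma_sc A ps)%E.
Proof.
apply/bigmin_geP; split=> [|i iS]; first exact: leey.
by rewrite lee_fin; exact: (r_bar_le_gap ps_nondeg tangent_neq0 iS).
Qed.

(** For an off-face vertex in the support put g = d - v_i(ps) >= 2rd. The test gives v_i(p) >= d -
    g/2, whereas (1 - r) v_i(p) <= d - g; together they force g (1 + r) <= 2rd, impossible. *)
Lemma loop_exit_sublevel p : spanning_design A p ->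
  ~~ loop_continues d (leverage A) c0 (gamma_sc A ps) p -> facial_sublevel A ps p.
Proof.
move=> sp /loop_stopsP [h1 h2]; have [[p0 p1] pM] := sp.
have fp := duality_gap ps_opt sp h1.
have r01 : 0 < r < 1 by rewrite r_gt0 /=; have := r_half; lra.
have lv := sublevel_leverage ps_opt pM r01 (grad_design_le0 d1 ps_opt (conj p0 p1)) fp.
split=> //; apply/fintype.subsetP => i; rewrite inE => pi; apply: contraT => iS.
have pi0 : 0 < p i 0 by rewrite lt_def pi p0.
have g := r_bar_le_gap ps_nondeg tangent_neq0 iS.
have /andP[lvi _] := lv i.
have lo : d%:R - (d%:R - leverage A ps i 0) * 2^-1 <= leverage A p i 0.
  rewrite -lee_fin EFinB EFinM; apply: le_trans (h2 i pi0).
  apply: leeB => //; have h : (0 <= (2^-1)%:E :> \bar R)%E by rewrite lee_fin.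
  exact: (lee_wpmul2r h (gamma_sc_le iS)).
exfalso; rewrite -/r in g lvi.
have rd := mulr_gt0 r_gt0 d0; have r1 : 0 <= 1 - r by have := r_half; lra.
have h3 : 0 < r * (d%:R - leverage A ps i 0) by rewrite mulr_gt0 //; lra.
move: lo; rewrite -subr_ge0 => /(mulr_ge0 r1); lra.
Qed.

(** On the face d <= (1 + r) v, so v >= (1 - r) d, and rd is at most half of [gamma_sc]. *)
Lemma loop_stops_on_face p : spanning_design A p -> supp p \subset S ->
  (gap A p <= (c0 / d%:R * d%:R)%:E)%E ->
  ~~ loop_continues d (leverage A) c0 (gamma_sc A ps) p.
Proof.
move=> sp su; rewrite divfK ?gt_eqF // => /vmax_subP h1; have [[p0 p1] pM] := sp.
have fp := duality_gap ps_opt sp h1.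
have r01 : 0 < r < 1 by rewrite r_gt0 /=; have := r_half; lra.
have lv := sublevel_leverage ps_opt pM r01 (grad_design_le0 d1 ps_opt (conj p0 p1)) fp.
apply/loop_stopsP; split=> // i pi.
have iS : i \in S by apply: (fintype.subsetP su); rewrite inE gt_eqF.
have /andP[_ lvi] := lv i; rewrite contact_leverage // in lvi.
have h : (0 <= (2^-1)%:E :> \bar R)%E by rewrite lee_fin.
apply: le_trans (_ : (d%:R - r * (2 * d%:R) * 2^-1)%:E <= _)%E.
  by rewrite EFinB EFinM; apply: leeB => //; exact: (lee_wpmul2r h r_bar_le_gamma).
rewrite lee_fin; have := leverage_ge0 i pM; have := d0; have := r_gt0.
move: (leverage A p i 0) lvi => v lvi rp dp v0.
nra.
Qed.

Variable p : nat -> 'cV[R]_n.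
Hypotheses (p_span : forall k, spanning_design A (p k))
  (p_step : forall k, away_step_update d (leverage A) (p k) (p k.+1)).

Lemma K_id_exists : exists K, is_K_id S p K.
Proof.
apply: (support_identified d1 ps_opt p_span p_step (c := r * (2 * d%:R))).
- by rewrite !mulr_gt0.
- by move=> i; exact: contact_leverage.
- by move=> i iS; have := r_bar_le_gap ps_nondeg tangent_neq0 iS; rewrite -/r; lra.
Qed.

Lemma K_gap_exists : exists K, is_K_gap A p (c0 / d%:R) K.
Proof.
have c_gt0 : 0 < c0 by exact: c_zero_gt0.
have [K hK] := leverage_cvg d1 ps_opt p_span p_step c_gt0.
exists K => k /hK h; rewrite divfK ?gt_eqF //; apply/vmax_subP => i.
have := h i; have := optimal_leverage_le d1 i ps_opt; rewrite ler_norml; lra.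
Qed.

Lemma loop_exit K_id K_gap : is_K_id S p K_id -> is_K_gap A p (c0 / d%:R) K_gap ->
  exists N, [/\ loop_exits_at d (leverage A) c0 (gamma_sc A ps) p N,
    (N <= maxn K_id K_gap)%N & facial_sublevel A ps (p N)].
Proof.
move=> hid hgap.
have stop : ~~ loop_continues d (leverage A) c0 (gamma_sc A ps) (p (maxn K_id K_gap)).
  by apply: loop_stops_on_face => //; [apply/hid/leq_maxl|apply/hgap/leq_maxr].
have [N hN Nmin] := ex_minnP (ex_intro
  (fun k => ~~ loop_continues d (leverage A) c0 (gamma_sc A ps) (p k)) _ stop).
exists N; split; [split=> // k kN| exact: Nmin|exact: loop_exit_sublevel].
by apply: contraLR kN => /Nmin; rewrite -leqNgt.
Qed.

End TwoStage.

Theorem corollary6p7 (R : realType) :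
  exists C : R, 0 < C /\
  forall (n d : nat) (A : 'M[R]_(n, d)) (ps : 'cV[R]_n),
    \rank A = d ->
    nondegenerate_optimal A ps ->
    (exists2 x : 'cV[R]_n, facial_tangent (contact_set A ps) x & x != 0) ->
    let face := contact_set A ps in
    let c0 := c_zero A ps in
    let accuracy_cost (eps : R) := C * d%:R ^+ 2 * loglog (theta_N A ps / eps) in
    [/\ exists p : nat -> 'cV[R]_n, away_sequence A p,
        forall p : nat -> 'cV[R]_n, away_sequence A p ->
          [/\ exists K, is_K_id face p K,
              exists K, is_K_gap A p (c0 / d%:R) K
            & forall K_id K_gap : nat,
                is_K_id face p K_id -> is_K_gap A p (c0 / d%:R) K_gap ->
                forall eps : R, 0 < eps < 1 ->
                exists (N : nat) (t : seq 'cV[R]_n) (r : 'cV[R]_n),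
                  let queries := loop_queries p N ++ t in
                  [/\ loop_exits_at d (leverage A) c0 (gamma_sc A ps) p N,
                      supp (p N) = face
                      /\ facial_newton d (leverage A) face eps (p N) t r,
                      legal_queries A queries,
                      john_ellipsoid A eps r
                    & (size queries)%:R
                        <= (maxn K_id K_gap)%:R + accuracy_cost eps]]
      & forall q : 'cV[R]_n, facial_sublevel A ps q ->
          forall eps : R, 0 < eps < 1 ->
          exists (t : seq 'cV[R]_n) (r : 'cV[R]_n),
            [/\ facial_newton d (leverage A) face eps q t r,
                legal_queries A t,
                john_ellipsoid A eps r
              & (size t)%:R <= accuracy_cost eps]].
Proof.
exists 70; split=> // n d A ps rA nd tan face c0 cost.
have d1 : (1 < d)%N := dim_gt1 nd tan.
have [i0 _] : exists i, i \in face.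
  by apply/card_gt0P/ltnW; exact: contact_card_gt1 tan.
split; first exact: away_sequence_exists i0 rA d1.
- move=> p [p0 p_step].
  have p_span := away_iterates_spanning d1
    (volumetric_init_spanning rA (ltnW d1) p0) p_step.
  split; [exact: K_id_exists|exact: K_gap_exists|].
  move=> K_id K_gap hid hgap eps e01.
  have [N [hN NK NC]] := loop_exit nd tan p_span hid hgap.
  have [t [r [[ft lt jr] st]]] := accuracy_phase nd tan NC e01.
  have [_ sN _] := sublevel_weights nd tan NC.
  exists N, t, r => queries; split=> //.
    move=> w; rewrite mem_cat => /orP[/mapP[k _ ->]|]; last exact: lt.
    by have [] := p_span k.
  rewrite size_cat size_mkseq natrD -natr1 -addrA [1 + _]addrC.
  by rewrite lerD // ler_nat.
- move=> q qC eps e01; have [t [r [[ft lt jr] st]]] := accuracy_phase nd tan qC e01.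
  by exists t, r; split=> //; apply: le_trans st; rewrite lerDl.
Qed.
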